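(* Let $n\ge 3$, let $Q\colon[0,\infty)\to(0,\infty)$ be monotone increasing with $r^2<Q(r)$ for all $r \geq 0$, and let $k>0$, $m\in\mathbb{N}$ and $R_m>0$ be such that (i) $Q$ is differentiable in $(R_m,\infty)$; (ii) $Q'(r)\,Q(r)^{-3/2}\to 0$ as $r\to\infty$; (iii) for all $r>R_m$: $\; r^2<\left(\int_0^r Q(t)^{1/2}\,\mathrm{d}t\right)\left(\ln^{(m)}\left(\int_0^r Q(t)^{1/2}\,\mathrm{d}t\right)\right)^{k}<Q(r)$. Let $d\in(0,1)$ and let $q\colon\mathbb{R}^n\to[0,\infty)$ be continuous with $$d\left(\int_0^{|x|}Q(t)^{1/2}\,\mathrm{d}t\right)\left(\ln^{(m)}\left(\int_0^{|x|}Q(t)^{1/2}\,\mathrm{d}t\right)\right)^{k}\le q(x)\le Q(|x|)$$ for every $x\in\mathbb{R}^n$ with $|x|\ge R_m$. Let $\varphi$ be the ground state of $H=-\Delta+q(x)$ in $\mathrm{L}^2(\mathbb{R}^n)$. Then $\varphi$ satisfies Rosen inequalities, i.e. for every $\varepsilon>0$ there exists $\gamma(\varepsilon)>0$ such that $$-\ln(\varphi(x))\le \varepsilon\, q(x)+\gamma(\varepsilon)\qquad\text{for almost every }x\in\mathbb{R}^n.$$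
   Context: $\ln^{(m)}$ denotes the $m$-fold iterated logarithm, $\ln^{(m)}(r)=\ln(\dots(\ln r)\dots)$ ($m$ times), $m\in\mathbb{N}=\{1,2,\dots\}$. The radius $R_m$ is understood to be large enough that $\ln^{(m)}\left(\int_0^r Q(t)^{1/2}\,\mathrm{d}t\right)$ is defined and non-negative for all $r\ge R_m$. For continuous $q\ge 0$, $H=-\Delta+q(x)$ is the non-negative self-adjoint operator in $\mathrm{L}^2(\mathbb{R}^n)$ associated with the closed quadratic form $h(u,v)=\langle\nabla u,\nabla v\rangle+\langle q u,v\rangle$ with form domain $D(h)=\{u\in H^1(\mathbb{R}^n): q^{1/2}u\in \mathrm{L}^2(\mathbb{R}^n)\}$. The ground state $\varphi$ is the continuous, strictly positive eigenfunction of $H$ with $\|\varphi\|_2=1$ associated with the lowest eigenvalue $E_0=\min\sigma(H)$; for the potentials considered here it exists and is unique. *)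

(* Defs.v *)
From HB Require Import structures.
From mathcomp Require Import all_boot all_order all_algebra.
From mathcomp Require Import all_classical all_reals all_analysis.
From mathcomp.real_closed Require Import complex.

Set Implicit Arguments.
Unset Strict Implicit.
Unset Printing Implicit Defensive.

Import Order.TTheory GRing.Theory Num.Theory.
Import numFieldNormedType.Exports.

Local Open Scope classical_set_scope.
Local Open Scope ring_scope.
Local Open Scope complex_scope.

Fact rV_display : measure_display.
Proof. exact: default_measure_display. Qed.

(* The product sigma-algebra on [R^n], generated by the coordinates; it is the
   Borel sigma-algebra. *)
Section rV_measurable.
Context (R : realType) (n : nat).

Let coors : 'I_n -> 'rV[R]_n -> measurableTypeR R := fun i x => x ord0 i.

Let rV_set0 : g_sigma_preimage coors set0.
Proof. exact: sigma_algebra0. Qed.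

Let rV_setC A : g_sigma_preimage coors A -> g_sigma_preimage coors (~` A).
Proof. exact: sigma_algebraC. Qed.

Let rV_bigcup (F : _^nat) : (forall i, g_sigma_preimage coors (F i)) ->
  g_sigma_preimage coors (\bigcup_i (F i)).
Proof. exact: sigma_algebra_bigcup. Qed.

HB.instance Definition _ := @isMeasurable.Build rV_display
  'rV[R]_n (g_sigma_preimage coors) rV_set0 rV_setC rV_bigcup.

Lemma measurable_coord (i : 'I_n) :
  measurable_fun [set: 'rV[R]_n] (fun x => x ord0 i : measurableTypeR R).
Proof.
move=> _ Y mY; rewrite setTI; apply: sub_sigma_algebra => /=.
rewrite -bigcup_seq/=; exists i => /=; first by rewrite mem_index_enum.
by exists Y => //; rewrite setTI.
Qed.

Lemma measurable_fun_rVP d (T : measurableType d) (f : T -> 'rV[R]_n) :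
  (forall i, measurable_fun [set: T] (fun t => f t ord0 i : measurableTypeR R)) ->
  measurable_fun [set: T] f.
Proof.
move=> mf _ Y mY; rewrite setTI.
suff : g_sigma_preimage coors `<=` [set B | measurable (f @^-1` B)] by move=> sub; exact: sub Y mY.
apply: smallest_sub.
  split => /=.
  - by rewrite preimage_set0.
  - by move=> B mB; rewrite setTD preimage_setC; exact: measurableC.
  - by move=> F mF; rewrite preimage_bigcup; exact: bigcup_measurable.
rewrite -bigcup_seq/=; apply: bigcup_sub => i _ B [C mC <-] /=.
by rewrite setTI; have := mf i measurableT _ mC; rewrite setTI.
Qed.

End rV_measurable.

Section lebesgue_rV.
Context (R : realType).

Definition rVcons n (p : 'rV[R]_n * measurableTypeR R) : 'rV[R]_n.+1 :=
  \row_(i < n.+1) oapp (fun j => p.1 ord0 j) p.2 (unlift ord0 i).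

Lemma measurable_rVcons n : measurable_fun setT (@rVcons n).
Proof.
apply: measurable_fun_rVP => i; rewrite /rVcons.
case: (unliftP ord0 i) => [j|] ->.
  under eq_fun do rewrite mxE liftK /=.
  exact: (measurableT_comp (measurable_coord j) measurable_fst).
under eq_fun do rewrite mxE unlift_none /=.
exact: measurable_snd.
Qed.

(* Lebesgue measure on [R^n], as an iterated product measure. *)
Fixpoint lebesgue_rV n : {measure set 'rV[R]_n -> \bar R} :=
  match n with
  | 0 => \d_(0 : 'rV[R]_0)
  | m.+1 => measure_function_pushforward__canonical__measure_function_Measure
      (lebesgue_rV m \x (@lebesgue_measure R))%E (@measurable_rVcons m)
  end.

End lebesgue_rV.

Section schrodinger.
Context (R : realType) (n : nat).
Local Notation V := 'rV[R]_n.
Local Notation mu := (@lebesgue_rV R n).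
Implicit Types (u v f : V -> R[i]) (q phi psi : V -> R).

(* The norm of the normed space ['rV[R]_n] is the sup norm. *)
Definition euclidean_norm (x : V) : R := Num.sqrt (\sum_(i < n) x ord0 i ^+ 2).

Definition partial (i : 'I_n) psi : V -> R := fun x => 'D_(delta_mx ord0 i) psi x.

Definition smooth psi := forall s : seq 'I_n,
  continuous (foldr partial psi s) /\
  forall i x, derivable (foldr partial psi s) x (delta_mx ord0 i).

Definition test_function psi :=
  smooth psi /\ compact (closure [set x | psi x != 0]).

Definition complex_integral u : R[i] :=
  (\int[mu]_x complex.Re (u x)) +i* (\int[mu]_x complex.Im (u x)).

Definition L2 u : Prop :=
  (fun x => complex.Re (u x)) \in Lfun mu 2%:E /\
  (fun x => complex.Im (u x)) \in Lfun mu 2%:E.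

Definition L2_norm u : \bar R := Lnorm mu 2%:E (fun x => (complex.Re `|u x|)%:E).

Definition L2_dot u v : R[i] := complex_integral (fun x => u x * (v x)^*).

(* Real test functions are enough: complex ones follow by linearity. *)
Definition weak_partial (i : 'I_n) u v := forall psi, test_function psi ->
  complex_integral (fun x => u x * (partial i psi x)%:C) =
  - complex_integral (fun x => v x * (psi x)%:C).

(* [g] is a representative of the weak gradient of [u], with [u] in [H^1]. *)
Definition H1_gradient u (g : 'I_n -> V -> R[i]) :=
  L2 u /\ forall i, L2 (g i) /\ weak_partial i u (g i).

Definition H1 u := exists g, H1_gradient u g.

Definition form_domain q u := H1 u /\ L2 (fun x => (Num.sqrt (q x))%:C * u x).

(* The value [h(u, v)], given representatives of the two weak gradients; these
   are unique up to null sets, hence so is the value. *)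
Definition form_value q u (gu : 'I_n -> V -> R[i]) v (gv : 'I_n -> V -> R[i]) :=
  \sum_(i < n) L2_dot (gu i) (gv i) + L2_dot (fun x => (q x)%:C * u x) v.

(* The graph of [H]: [u] is in [D(H)] and [H u = f] when [u] is in [D(h)],
   [f] is in [L^2] and [h(u, v) = <f, v>] for all [v] in [D(h)]. *)
Definition schrodinger q u f :=
  [/\ form_domain q u, L2 f &
      forall gu v gv, H1_gradient u gu -> form_domain q v -> H1_gradient v gv ->
        form_value q u gu v gv = L2_dot f v].

Definition resolvent_set q : set R[i] := [set z | exists C : R,
  forall f, L2 f -> exists u,
    [/\ schrodinger q u (fun x => z * u x + f x),
        (L2_norm u <= C%:E * L2_norm f)%E &
        forall v, schrodinger q v (fun x => z * v x + f x) ->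
          {ae mu, forall x, v x = u x}]].

Definition spectrum q : set R[i] := ~` resolvent_set q.

(* The order of [R[i]] compares only numbers with the same imaginary part, so
   the second condition also says that the spectrum is real. *)
Definition lowest_eigenvalue q (E0 : R) :=
  spectrum q E0%:C /\ forall z, spectrum q z -> E0%:C <= z.

Definition ground_state q phi :=
  [/\ continuous phi, forall x, 0 < phi x, L2_norm (fun x => (phi x)%:C) = 1%E &
      exists2 E0 : R, lowest_eigenvalue q E0 &
        schrodinger q (fun x => (phi x)%:C) (fun x => (E0 * phi x)%:C)].

Definition rosen_inequalities q phi := forall eps : R, 0 < eps ->
  exists2 gamma : R, 0 < gamma &
    {ae mu, forall x, - ln (phi x) <= eps * q x + gamma}.

End schrodinger.

Definition iterated_ln (R : realType) (m : nat) (x : R) : R := iter m (@ln R) x.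

(* [ln] is total, with [ln x = 0] for [x <= 0]. *)
Definition iterated_ln_defined (R : realType) (m : nat) (x : R) :=
  forall j, (j < m)%N -> 0 < iterated_ln j x.

Definition sqrt_primitive (R : realType) (Q : R -> R) (r : R) : R :=
  \int[lebesgue_measure]_(t in `[0, r]) Num.sqrt (Q t).

(* Main.v *)
(* With F(r) the integral of Q^(1/2) over [0, r], the function exp (- 2 F(|x|))
   is a subsolution of - Delta + 2 Q outside a large ball: the term 4 Q in its
   Laplacian beats the other two, because Q' Q^(-3/2) -> 0 and r^2 < Q(r). A
   comparison with phi gives phi >= c exp (- 2 F(|x|)), that is - ln phi <=
   2 F + const, and F is at most a small multiple of q since q >= d F (ln^(m) F)^k
   and ln^(m) F -> +oo.

   The comparison is carried out on annuli, for phi as a viscosity solution. The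
   weak equation is only tested against smooth functions, where it says that
   Delta phi = (q - E0) phi as a distribution. If the distributional Laplacian of
   a continuous function w is negative near a local minimum x0, then radial means
   of w around x0 decrease with the radius, since the derivative in the radius of
   a suitable radial kernel is the Laplacian of another one; this is absurd.
   Hence a C^2 function touching phi from below at x0 has Laplacian at most
   (q - E0) phi at x0. *)

Require Import Defs.
From HB Require Import structures.
From mathcomp Require Import all_boot all_order all_algebra.
From mathcomp Require Import all_classical all_reals all_analysis.
From mathcomp.real_closed Require Import complex.
From mathcomp Require Import measurable_realfun.
From mathcomp Require Import ring lra.

Set Implicit Arguments.
Unset Strict Implicit.
Unset Printing Implicit Defensive.

Import Order.TTheory GRing.Theory Num.Theory.
Import numFieldNormedType.Exports.

Local Open Scope classical_set_scope.
Local Open Scope ring_scope.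

(** * The topology and the Lebesgue measure of [R^n] *)

(** [Q] is only differentiable, so the second derivative of the barrier exists but may be
    discontinuous: integration by parts for functions of class C^2 does not apply to the barrier
    itself. This is why the comparison is pointwise. At a contact point the barrier is replaced by a
    polynomial of degree two in |x|^2 that lies below it nearby, at the price of a small error in
    the second derivative. All radial functions are therefore written in the variable s = |x|^2,
    which is smooth in x. The kernel identity is a scaling fact. The derivative in tau of tau^n
    G(tau z) is tau^(n-1) times the divergence of z G(tau z), and this field is a gradient when G is
    radial. With b_k(t) = t^(-k) exp(- 1/t) for t > 0 one has b_0' = b_2, so G(z) = b_2(1 - |z|^2)
    yields, up to a negative factor, the Laplacian of b_0(1 - tau^2 |z|^2). The second kernel is a
    nonnegative test function, so the sign of a distributional Laplacian decides the monotonicity of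
    the means taken with the first one. The outer radius of the annulus is chosen after the point x,
    far enough to cost only a factor 2; the constant in the lower bound is then the same for all
    x. *)

Section rV_topology.
Context (R : realType) (n : nat).
Implicit Types (x c : 'rV[R]_n) (r : R).

Lemma rV_norm_leP x r : 0 <= r ->
  reflect (forall i, `|x ord0 i| <= r) (`|x| <= r).
Proof.
move=> r0; rewrite [`|x|]/Num.norm /= mx_normrE.
apply: (iffP idP) => [/bigmax_leP[_ H] i|H]; first exact: (H (ord0, i)).
by apply/bigmax_leP; split => // -[i j] _ /=; rewrite ord1.
Qed.

Lemma rV_norm_ltP x r : 0 < r ->
  reflect (forall i, `|x ord0 i| < r) (`|x| < r).
Proof.
move=> r0; rewrite [`|x|]/Num.norm /= mx_normrE.
apply: (iffP idP) => [/bigmax_ltP[_ H] i|H]; first exact: (H (ord0, i)).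
by apply/bigmax_ltP; split => // -[i j] _ /=; rewrite ord1.
Qed.

Lemma rV_coord_le x i : `|x ord0 i| <= `|x|.
Proof. by move: i; apply/rV_norm_leP. Qed.

Lemma continuous_coord (i : 'I_n) : continuous (fun x => x ord0 i).
Proof.
by move=> x; exact: coord_continuous.
Qed.

(** The closed ball of the sup norm. Such neighbourhoods are products of intervals, so the iterated
    product measure gives their volume at once. *)
Definition cube c r : set 'rV[R]_n := [set x | `|x - c| <= r].

Lemma cubeE c r : 0 <= r ->
  cube c r = \bigcap_(i in [set: 'I_n]) [set x | `|x ord0 i - c ord0 i| <= r].
Proof.
move=> r0; apply/seteqP; split => [x /(rV_norm_leP _ r0) H i _ /=|x H].
  by have := H i; rewrite !mxE.
by apply/(rV_norm_leP _ r0) => i; have := H i I; rewrite /= !mxE.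
Qed.

Lemma closed_cube c r : closed (cube c r).
Proof.
have -> : cube c r = (fun x => `|x - c|) @^-1` [set y | y <= r] by [].
have : continuous (fun x : 'rV[R]_n => `|x - c|).
  move=> x; apply: (@continuous_comp _ _ _ (fun x : 'rV[R]_n => x - c) Num.norm);
    last exact: norm_continuous.
  by apply: (@continuousB _ _ _ id (cst c)) => //; exact: cst_continuous.
by move=> /continuous_closedP; apply; exact: closed_le.
Qed.

Lemma compact_cube c r : compact (cube c r).
Proof.
apply: bounded_closed_compact; last exact: closed_cube.
exists (`|c| + r); split; first exact: num_real.
move=> M ltM x xc; rewrite -[x](subrK c).
apply: le_trans (ler_normD _ _) _; apply: le_trans (ltW ltM).
by rewrite addrC lerD2l.
Qed.

Lemma near_cube (P : set 'rV[R]_n) c : (\forall x \near c, P x) ->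
  exists2 d, 0 < d & cube c d `<=` P.
Proof.
move=> /nbhs_ballP[d /= d0 Hd]; exists (d / 2); first by rewrite divr_gt0.
move=> x; rewrite /cube /= distrC => xd; apply: Hd; rewrite -ball_normE /=.
by apply: le_lt_trans xd _; rewrite ltr_pdivrMr// mulr_natr mulr2n ltrDl.
Qed.

(** An open set is the union of the boxes with rational centre and radius that it contains: a
    countable family of finite intersections of coordinate preimages. *)
Lemma measurable_open_rV (A : set 'rV[R]_n) : open A -> measurable A.
Proof.
move=> oA.
pose box (p : 'rV[rat]_n * rat) : set 'rV[R]_n :=
  \bigcap_(i in [set: 'I_n]) [set x | `|x ord0 i - ratr (p.1 ord0 i)| < ratr p.2].
have mbox p : measurable (box p).
  apply: fin_bigcap_measurable; first exact: finite_finset.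
  move=> i _; have mB : measurable (ball (ratr (p.1 ord0 i) : R) (ratr p.2) : set
    (measurableTypeR R)).
    by apply: open_measurable; exact: ball_open.
  have := @measurable_coord R n i measurableT _ mB; rewrite setTI.
  congr (measurable _); apply/seteqP.
  by split => x /=; rewrite -ball_normE /= distrC.
pose P : set ('rV[rat]_n * rat) := [set p | box p `<=` A].
have -> : A = \bigcup_p (if p \in P then box p else set0).
  apply/seteqP; split => [x Ax|x [p _]]; last first.
    by case: ifPn => // /set_mem; apply.
  have /nbhs_ballP[e /= e0 xeA] : nbhs x A by exact: open_nbhs_nbhs.
  (* The radius is below e / 2 because the box is centred near x, not at x: its points are within
     twice the radius of x. *)
  have [q] := @rat_in_itvoo R 0 (e / 2) ltac:(by rewrite divr_gt0).
  rewrite in_itv /= => /andP[q0 qe].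
  have /choice[g Hg] (i : 'I_n) : exists s : rat, `|x ord0 i - ratr s| < ratr q.
    have [s] := @rat_in_itvoo R (x ord0 i) (x ord0 i + ratr q) ltac:(by rewrite ltrDl).
    rewrite in_itv /= => /andP[s1 s2]; exists s.
    by rewrite distrC ger0_norm ?subr_ge0 ?(ltW s1)// ltrBlDl.
  exists (\row_i g i, q) => //; rewrite ifT; last first.
    apply/mem_set => y ybox; apply: xeA; rewrite -ball_normE /=.
    apply/(rV_norm_ltP _ e0) => i; rewrite !mxE.
    have := ybox i I; rewrite /= mxE => yi.
    rewrite -[x ord0 i](subrK (ratr (g i))) -addrA;
      apply: le_lt_trans (ler_normD _ _) _.
    by rewrite [e]splitr; apply: ltrD; [exact: lt_trans (Hg i) _|rewrite distrC;
      exact: lt_trans yi _].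
  by move=> i _ /=; rewrite mxE; exact: Hg.
apply: countable_bigcupT_measurable => [|p]; last by case: ifPn.
exact: countableP.
Qed.

Lemma continuous_measurable_rV (f : 'rV[R]_n -> R) : continuous f ->
  measurable_fun [set: 'rV[R]_n] (f : 'rV[R]_n -> measurableTypeR R).
Proof.
move=> cf; apply: (measurability _ (RGenOpens.measurableE R)).
move=> _ [_ [a [b ->] <-]]; rewrite setTI; apply: measurable_open_rV.
by move: cf => /continuousP; apply; exact: interval_open.
Qed.

End rV_topology.

Section lebesgue_rV_measure.
Context (R : realType).

Lemma measurable_cube n (c : 'rV[R]_n) r : measurable (cube c r).
Proof.
rewrite -[cube c r]setCK; apply: measurableC; apply: measurable_open_rV.
by apply: closed_openC; exact: closed_cube.
Qed.

Lemma lebesgue_rV_cube n (c : 'rV[R]_n) (r : R) : 0 <= r ->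
  lebesgue_rV R n (cube c r) = ((r *+ 2) ^+ n)%:E.
Proof.
move=> r0; elim: n c => [|n IH] c.
  have -> : cube c r = setT.
    by apply/seteqP; split => // x _; rewrite cubeE// => -[].
  by rewrite expr0 /= diracE mem_set.
rewrite /= /pushforward.
have -> : @rVcons R n @^-1` cube c r =
    cube (\row_j c ord0 (lift ord0 j)) r `*` `[c ord0 ord0 - r, c ord0 ord0 +
      r]%classic.
  apply/seteqP; split => [[x t]|[x t] [/=]].
    rewrite cubeE//= => H; split.
      rewrite cubeE// => i _ /=; have := H (lift ord0 i) I.
      by rewrite /= !mxE liftK.
    have := H ord0 I; rewrite /= !mxE unlift_none /= in_itv /=.
    by rewrite ler_norml lerBrDr lerBlDr (addrC (- r)) (addrC r).
  rewrite !cubeE// in_itv /= => H Ht i _ /=; rewrite mxE.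
  case: (unliftP ord0 i) => [j|] -> /=; first by have := H j I; rewrite /= !mxE.
  by rewrite ler_norml lerBrDr lerBlDr (addrC (- r)) (addrC r).
rewrite product_measure1E//; last exact: measurable_cube.
rewrite [X in (X * _)%E](IH (\row_j c ord0 (lift ord0 j))).
rewrite [X in (_ * X)%E](_ : _ = (r *+ 2)%:E); first by rewrite -EFinM exprSr.
rewrite [LHS]lebesgue_measure_itv /= lte_fin.
case: ltP => [_|]; first by rewrite -EFinB mulr2n; congr (_%:E); ring.
move=> h; have -> : r = 0 by apply/eqP; rewrite eq_le r0 andbT; move: h; lra.
by rewrite mul0rn.
Qed.

Lemma lebesgue_rV_cube_lty n (c : 'rV[R]_n) (r : R) :
  (lebesgue_rV R n (cube c r) < +oo)%E.
Proof.
have [r0|r0] := leP 0 r; first by rewrite lebesgue_rV_cube// ltry.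
have -> : cube c r = set0.
  apply/seteqP; split => // x; rewrite /cube /= => h.
  by have := le_lt_trans (le_trans (normr_ge0 _) h) r0; rewrite ltxx.
by rewrite measure0.
Qed.

Lemma lebesgue_rV_sigma_finite n : sigma_finite [set: 'rV[R]_n] (lebesgue_rV R n).
Proof.
exists (fun k => cube 0 k%:R).
  apply/seteqP; split => // x _; exists (Num.truncn `|x|).+1 => //=.
  rewrite /cube /= subr0; apply/ltW; exact: truncnS_gt.
by move=> k; split; [exact: measurable_cube|exact: lebesgue_rV_cube_lty].
Qed.

(* [lebesgue_rV] is a bundled measure; its underlying set function carries the
   sigma-finiteness that Fubini's theorem requires. *)
Definition lebesgue_rV_fun n : set 'rV[R]_n -> \bar R := lebesgue_rV R n.
HB.instance Definition _ n := Measure.copy (@lebesgue_rV_fun n) (lebesgue_rV R n).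
HB.instance Definition _ n := Measure_isSigmaFinite.Build _ _ _
  (@lebesgue_rV_fun n) (@lebesgue_rV_sigma_finite n).

Lemma continuous_integrable_cube n (f : 'rV[R]_n -> R) c r : continuous f ->
  (lebesgue_rV R n).-integrable (cube c r) (EFin \o f).
Proof.
move=> cf; apply: measurable_bounded_integrable.
- exact: measurable_cube.
- exact: lebesgue_rV_cube_lty.
- by apply: measurable_funTS; exact: continuous_measurable_rV.
- have /compact_bounded[M [_ H]] : compact (f @` cube c r).
    apply: continuous_compact; last exact: compact_cube.
    exact: continuous_subspaceT.
  by exists M; split; rewrite ?num_real// => ? ? ? ?; exact: H.
Qed.

End lebesgue_rV_measure.

(** * The divergence theorem for compactly supported functions *)

Section divergence.
Context (R : realType).

(** An explicit radius around 0 passes unchanged to all sections of the function, which the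
    induction on the dimension needs. *)
Definition supported n (f : 'rV[R]_n -> R) (r : R) := forall x, r < `|x| -> f x = 0.

Lemma integral_supported n (f : 'rV[R]_n -> R) r : supported f r ->
  (\int[lebesgue_rV R n]_x (f x)%:E = \int[lebesgue_rV R n]_(x in cube 0 r) (f x)%:E)%E.
Proof.
move=> sf; rewrite [RHS]integral_mkcond; apply: eq_integral => x _.
rewrite patchE; case: ifPn => //; rewrite notin_setE /cube /= subr0 => /negP.
by rewrite -ltNge => /sf ->.
Qed.

Lemma integrable_supported n (f : 'rV[R]_n -> R) r : continuous f ->
  supported f r -> (lebesgue_rV R n).-integrable setT (EFin \o f).
Proof.
move=> cf sf.
have := @continuous_integrable_cube R n f 0 r cf.
move/(integrable_mkcond _ (measurable_cube 0 r)); congr (integrable _ _ _).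
apply/funext => x; rewrite patchE; case: ifPn => //.
by rewrite notin_setE /cube /= subr0 => /negP; rewrite -ltNge => /sf ->.
Qed.

Lemma cvg_rV (T : Type) (F : set_system T) (FF : Filter F) n (f : T -> 'rV[R]_n)
    (l : 'rV[R]_n) :
  (forall i, f t ord0 i @[t --> F] --> l ord0 i) -> f t @[t --> F] --> l.
Proof.
move=> H; apply/cvgrPdist_lt => e e0.
have : \forall t \near F, forall i, `|l ord0 i - f t ord0 i| < e.
  by apply: filter_forall => i; move/cvgrPdist_lt : (H i); exact.
by apply: filterS => t Ht; apply/(rV_norm_ltP _ e0) => i; rewrite !mxE; exact: Ht.
Qed.

Lemma continuous_rVcons1 n (t : R) : continuous (fun x : 'rV[R]_n => rVcons (x, t)).
Proof.
move=> x; apply: (@cvg_rV _ _ (nbhs_filter x)) => i; rewrite /rVcons.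
case: (unliftP ord0 i) => [j|] ->.
  rewrite mxE liftK /=; under eq_fun do rewrite mxE liftK /=.
  exact: continuous_coord.
rewrite mxE unlift_none /=; under eq_fun do rewrite mxE unlift_none /=.
exact: cvg_cst.
Qed.

Lemma continuous_rVcons2 n (x : 'rV[R]_n) : continuous (fun t : R => rVcons (x, t)).
Proof.
move=> t; apply: cvg_rV => i; rewrite /rVcons.
case: (unliftP ord0 i) => [j|] ->.
  rewrite mxE liftK /=; under eq_fun do rewrite mxE liftK /=.
  exact: cvg_cst.
rewrite mxE unlift_none /=; under eq_fun do rewrite mxE unlift_none /=.
exact: cvg_id.
Qed.

Lemma rVcons_shift0 n (x : 'rV[R]_n) (t h : R) :
  h *: delta_mx ord0 ord0 + rVcons (x, t) = rVcons (x, h + t).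
Proof.
apply/rowP => i; rewrite /rVcons !mxE; case: (unliftP ord0 i) => [j|] -> /=.
  by rewrite mulr0 add0r.
by rewrite mulr1.
Qed.

Lemma rVcons_shift n (x : 'rV[R]_n) (t h : R) j :
  h *: delta_mx ord0 (lift ord0 j) + rVcons (x, t) =
  rVcons (h *: delta_mx ord0 j + x, t).
Proof.
apply/rowP => i; rewrite /rVcons !mxE; case: (unliftP ord0 i) => [l|] -> /=.
  by rewrite !mxE (inj_eq lift_inj).
by rewrite mulr0 add0r.
Qed.

Lemma is_derive_rVcons0 n (f : 'rV[R]_n.+1 -> R) g x (t : R) :
  is_derive (rVcons (x, t)) (delta_mx ord0 ord0) f g ->
  is_derive t 1 (fun t => f (rVcons (x, t))) g.
Proof.
have E : (fun h : R => h^-1 *: (((fun t =>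
  f (rVcons (x, t))) \o shift t) (h *: 1) - f (rVcons (x, t))))
  = (fun h : R => h^-1 *: ((f \o shift (rVcons (x, t)))
    (h *: delta_mx ord0 ord0) - f (rVcons (x, t)))).
  by apply/funext => h /=; rewrite rVcons_shift0 [h *: 1]mulr1.
move=> [df Df]; split; first by rewrite /derivable E.
by rewrite -Df /derive E.
Qed.

Lemma is_derive_rVcons n (f : 'rV[R]_n.+1 -> R) g x (t : R) j :
  is_derive (rVcons (x, t)) (delta_mx ord0 (lift ord0 j)) f g ->
  is_derive x (delta_mx ord0 j) (fun x => f (rVcons (x, t))) g.
Proof.
have E : (fun h : R => h^-1 *: (((fun x =>
  f (rVcons (x, t))) \o shift x) (h *: delta_mx ord0 j) - f (rVcons (x, t))))
  = (fun h : R => h^-1 *: ((f \o shift (rVcons (x, t))) (h *: delta_mx ord0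
    (lift ord0 j)) - f (rVcons (x, t)))).
  by apply/funext => h /=; rewrite rVcons_shift.
move=> [df Df]; split; first by rewrite /derivable E.
by rewrite -Df /derive E.
Qed.

Lemma rVcons_norm1 n (x : 'rV[R]_n) t : `|x| <= `|rVcons (x, t)|.
Proof.
apply/rV_norm_leP => // i; have := rV_coord_le (rVcons (x, t)) (lift ord0 i).
by rewrite mxE liftK.
Qed.

Lemma rVcons_norm2 n (x : 'rV[R]_n) t : `|t| <= `|rVcons (x, t)|.
Proof.
by have := rV_coord_le (rVcons (x, t)) ord0; rewrite mxE unlift_none.
Qed.

Section fubini_rV.
Context n (g : 'rV[R]_n.+1 -> R) (r : R).
Hypotheses (cg : continuous g) (sg : supported g r).

Let ig := integrable_supported cg sg.
Let mg : measurable_fun setT (EFin \o g).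
Proof. exact: measurable_int ig. Qed.

Lemma integrable_rVcons : ((@lebesgue_rV_fun R n) \x
  (@lebesgue_measure R))%E.-integrable setT
  ((EFin \o g) \o @rVcons R n).
Proof.
apply/integrableP; split.
  by apply: measurableT_comp => //; exact: measurable_rVcons.
have /integrableP[_] := ig; rewrite /=.
rewrite (ge0_integral_pushforward (@measurable_rVcons R n))//.
exact: (measurableT_comp (@abse_measurable R setT) mg).

Qed.

Lemma integral_rVcons : (\int[lebesgue_rV R n.+1]_x (g x)%:E =
  \int[(@lebesgue_rV_fun R n) \x (@lebesgue_measure R)]_p (g (rVcons p))%:E)%E.
Proof.
rewrite /= (@integral_pushforward _ _ _ _ _ _ (@measurable_rVcons R n) _ setT
  (EFin \o g)) //.
exact: integrable_rVcons.
Qed.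

Lemma fubini_rV1 : (\int[lebesgue_rV R n.+1]_x (g x)%:E =
  \int[lebesgue_rV R n]_x \int[lebesgue_measure]_t (g (rVcons (x, t)))%:E)%E.
Proof. by rewrite integral_rVcons -(integral12_prod_meas1 integrable_rVcons). Qed.

Lemma fubini_rV2 : (\int[lebesgue_rV R n.+1]_x (g x)%:E =
  \int[lebesgue_measure]_t \int[lebesgue_rV R n]_x (g (rVcons (x, t)))%:E)%E.
Proof. by rewrite integral_rVcons -(integral21_prod_meas1 integrable_rVcons). Qed.

End fubini_rV.

Lemma integral_derivative_supported (F f : R -> R) (r : R) : continuous f ->
  (forall t : R, is_derive t 1 F (f t)) ->
  (forall t : R, r < `|t| -> F t = 0) -> (forall t : R, r < `|t| -> f t = 0) ->
  (\int[lebesgue_measure]_t (f t)%:E = 0)%E.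
Proof.
(* [F] vanishes at both ends of [-M, M]. The absolute value is there because r may be negative. *)
move=> cf dF sF sf; pose M : R := `|r| + 1.
have rM : r < `|M| by rewrite ger0_norm ?addr_ge0//;
  apply: (le_lt_trans (ler_norm r)); rewrite ltrDl.
have M0 : 0 < M by rewrite ltr_wpDl.
have cF : continuous F by move=> t;
  apply/differentiable_continuous/derivable1_diffP; have [] := dF t.
have NM : - M < M by lra.
transitivity (\int[lebesgue_measure]_(t in `[(- M)%R, M]) (f t)%:E)%E; last first.
  rewrite (@continuous_FTC2 _ f F)//.
  - by rewrite !sF ?normrN// subee.
  - exact: continuous_subspaceT.
  - split.
    + by move=> t _; have [] := dF t.
    + exact/cvg_at_right_filter/cF.
    + exact/cvg_at_left_filter/cF.
  - by move=> t _; rewrite derive1E; have [] := dF t.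
rewrite [RHS]integral_mkcond; apply: eq_integral => t _.
rewrite patchE; case: ifPn => // /negP; rewrite inE /= in_itv /= => /negP.
rewrite -ler_norml -ltNge => h; rewrite sf//.
by apply: lt_trans h; rewrite (le_lt_trans (ler_norm r))// ltrDl.
Qed.

(** Induction on the dimension. The order of integration in Fubini is chosen so that the inner
    integral contains the direction of the derivative and vanishes: by induction, or by the
    fundamental theorem of calculus for the coordinate added last. *)
Lemma integral_partial_supported n (f g : 'rV[R]_n -> R) i r :
  continuous g -> (forall x, is_derive x (delta_mx ord0 i) f (g x)) ->
  supported f r -> supported g r -> (\int[lebesgue_rV R n]_x (g x)%:E = 0)%E.
Proof.
elim: n f g i => [|n IH] f g i cg df sf sg; first by case: i {df}.
case: (unliftP ord0 i) df => [j|] -> df.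
  rewrite (fubini_rV2 cg sg); apply: integral0_eq => t _.
  apply: (IH (fun x => f (rVcons (x, t))) _ j) => [x|x|x xr|x xr].
  - apply: (@continuous_comp _ _ _ (fun x => rVcons (x, t)) g); last exact: cg.
    exact: continuous_rVcons1.
  - exact: is_derive_rVcons.
  - by apply: sf; exact: lt_le_trans xr (rVcons_norm1 _ _).
  - by apply: sg; exact: lt_le_trans xr (rVcons_norm1 _ _).
rewrite (fubini_rV1 cg sg); apply: integral0_eq => x _.
apply: (@integral_derivative_supported (fun t => f (rVcons (x, t))) _ r) =>
  [t|t|t tr|t tr].
- apply: (@continuous_comp _ _ _ (fun t : R => rVcons (x, t)) g); last exact: cg.
  exact: continuous_rVcons2.
- exact: is_derive_rVcons0.
- by apply: sf; exact: lt_le_trans tr (rVcons_norm2 _ _).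
- by apply: sg; exact: lt_le_trans tr (rVcons_norm2 _ _).
Qed.

End divergence.

(** * Smooth functions and the bump [exp (- 1 / x)] *)

Section smooth_bump.
Context (R : realType).

(** The negative powers make the family stable under differentiation: the derivative of member k is
    a combination of members k + 1 and k + 2. Smoothness becomes an induction and Laplacians stay
    explicit. *)
Definition exp_bump (k : nat) (x : R) : R :=
  if 0 < x then x^-1 ^+ k * expR (- x^-1) else 0.

Lemma exp_bump_ge0 k x : 0 <= exp_bump k x.
Proof.
rewrite /exp_bump; case: ifP => // x0.
by rewrite mulr_ge0 ?expR_ge0// exprn_ge0// invr_ge0 ltW.
Qed.

Lemma exp_bump_gt0 k x : 0 < x -> 0 < exp_bump k x.
Proof. by move=> x0; rewrite /exp_bump x0 mulr_gt0 ?expR_gt0// exprn_gt0//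
  invr_gt0. Qed.

Lemma exp_bump_eq0 k x : x <= 0 -> exp_bump k x = 0.
Proof. by rewrite /exp_bump leNgt => /negbTE ->. Qed.

(** With y = 1/x this is y^k <= k! exp y, from the exponential series. *)
Lemma exp_bump_le k x : exp_bump k x <= k`!%:R.
Proof.
rewrite /exp_bump; case: ifP => // x0.
have y0 : 0 <= x^-1 by rewrite invr_ge0 ltW.
rewrite expRN ler_pdivrMr ?expR_gt0// -ler_pdivrMl ?ltr0n ?fact_gt0// mulrC.
case: k => [|k]; first by rewrite expr0 fact0 invr1 mulr1 -expR0 ler_expR.
by apply: le_trans (expR_ge1Dxn k y0); rewrite lerDr.
Qed.

Lemma exp_bumpS k x : 0 < x -> exp_bump k x = x * exp_bump k.+1 x.
Proof. by move=> x0; rewrite /exp_bump x0 exprS !mulrA mulfV ?gt_eqF// mul1r. Qed.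

Lemma is_derive_exp_bump k (x : R) :
  is_derive x 1 (exp_bump k) (exp_bump k.+2 x - k%:R * exp_bump k.+1 x).
Proof.
have [x0|x0|->] := ltgtP x 0.
- rewrite !exp_bump_eq0 ?(ltW x0)// mulr0 subrr.
  apply: (@near_eq_is_derive _ _ _ (cst 0)) => //.
  near=> y; rewrite /cst exp_bump_eq0//; near: y.
  by apply: filterS (lt_nbhsl x0) => y /ltW.
- have dinv : is_derive x 1 (fun y : R => y^-1) (- x ^- 2).
    apply: is_derive_eq; first by apply: (@is_deriveV _ id); rewrite ?gt_eqF.
    by rewrite /= [_ *: _]mulr1.
  apply: (@near_eq_is_derive _ _ _ (fun y : R => y^-1 ^+ k * expR (- y^-1))).
    near=> y; rewrite /exp_bump ifT//; near: y.
    exact: lt_nbhsr.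
  have dexp : is_derive x 1 (fun y : R => expR (- y^-1)) (expR (- x^-1) * x ^- 2).
    have dN : is_derive x 1 (fun y : R => - y^-1) (x ^- 2).
      by have := is_deriveN dinv; rewrite opprK.
    exact: (@is_derive1_comp _ expR (fun y : R => - y^-1) x _ _ (is_derive_expR _) dN).
  have H := is_deriveM (@is_deriveX _ _ (fun y : R => y^-1) k x 1 _ dinv) dexp.
  suff <- : (fun y : R => y^-1) x ^+ k *: (expR (- x^-1) * x ^- 2) +
    expR (- x^-1) *: ((k%:R * x^-1 ^+ k.-1) *: (- x ^- 2)) =
    exp_bump k.+2 x - k%:R * exp_bump k.+1 x by rewrite exprfctE in H; exact: H.
  rewrite /exp_bump x0 /=.
  have xn0 : x != 0 by rewrite gt_eqF.
  rewrite /GRing.scale /=.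
  case: k {H} => [|k] /=; first by rewrite !exprVn expr0; field.
  by rewrite !exprVn !exprS; field; rewrite expf_neq0.
- rewrite !exp_bump_eq0// mulr0 subrr.
  (* For h > 0 the difference quotient at 0 equals h times member k + 2 of the family, hence is at
     most h (k + 2)!. *)
  have H : h^-1 *: (((exp_bump k) \o shift 0) (h *: 1) - exp_bump k 0) @[h -->
    (0:R)^'] --> (0 : R).
    rewrite exp_bump_eq0//; under eq_fun do rewrite /= subr0 addr0 [_ *: 1]mulr1.
    apply/cvgrPdist_le => e e0; near=> h.
    rewrite sub0r normrN.
    have [h0|h0] := leP h 0; first by rewrite exp_bump_eq0// scaler0 normr0 ltW.
    rewrite exp_bumpS// exp_bumpS// [_ *: _]mulrA mulrA mulVf ?gt_eqF// mul1r.
    rewrite normrM ger0_norm ?(ltW h0)// ger0_norm ?exp_bump_ge0//.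
    apply: (@le_trans _ _ (h * k.+2`!%:R)).
      by rewrite ler_wpM2l ?(ltW h0)// exp_bump_le.
    rewrite -ler_pdivlMr ?ltr0n ?fact_gt0//.
    apply: le_trans (ler_norm h) _; near: h.
    apply: dnbhs0_le; by rewrite divr_gt0// ltr0n fact_gt0.
  split; first by apply/cvg_ex; exists 0.
  exact/cvg_lim.
Unshelve. all: by end_near. Qed.

Fixpoint smooth_upto (k : nat) (f : R -> R) : Prop :=
  continuous f /\
  if k is k'.+1 then (forall x, derivable f x 1) /\ smooth_upto k'
    (derive1 f) else True.

Lemma smooth_uptoD k f g : smooth_upto k f -> smooth_upto k g -> smooth_upto k (f + g).
Proof.
elim: k f g => [|k IH] f g [cf Hf] [cg Hg]; split => //=.
1,2: by move=> x; apply: cvgD; [exact: cf|exact: cg].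
move: Hf Hg => [df sf] [dg sg]; split; first by move=> x; apply: derivableD.
have -> : derive1 (f + g) = derive1 f + derive1 g by apply/funext => x;
  rewrite [RHS](_ : _ = derive1 f x + derive1 g x)// !derive1E deriveD.
exact: IH.
Qed.

Lemma smooth_uptoZ k f (a : R) : smooth_upto k f -> smooth_upto k (a \*: f).
Proof.
elim: k f => [|k IH] f [cf Hf]; split => //=.
1,2: by move=> x; apply: cvgZr; exact: cf.
move: Hf => [df sf]; split; first by move=> x; apply: derivableZ.
have -> : derive1 (a \*: f) = a \*: derive1 f by apply/funext => x;
  rewrite [RHS](_ : _ = a *: derive1 f x)// !derive1E deriveZ.
exact: IH.
Qed.

Lemma continuous_exp_bump k : continuous (exp_bump k).
Proof.
by move=> x; apply/differentiable_continuous/derivable1_diffP;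
  have [] := is_derive_exp_bump k x.
Qed.

Lemma smooth_upto_exp_bump j k : smooth_upto j (exp_bump k).
Proof.
elim: j k => [|j IH] k; split => //=; try exact: continuous_exp_bump.
split; first by move=> x; have [] := is_derive_exp_bump k x.
have -> : derive1 (exp_bump k) = exp_bump k.+2 + (- k%:R) \*: exp_bump k.+1.
  apply/funext => x; rewrite derive1E; have [_ ->] := is_derive_exp_bump k x.
  by rewrite !fctE /= [_ *: _]mulNr.
by apply: smooth_uptoD => //; apply: smooth_uptoZ.
Qed.

End smooth_bump.

(** * Functions of class C^k on R^n and test functions *)

Section Ck.
Context (R : realType) (n : nat).
Local Notation V := 'rV[R]_n.
Local Notation e := (fun i : 'I_n => delta_mx ord0 i : V).

(** Restricting to a line turns directional derivatives into ordinary ones, so the chain rule in one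
    variable applies. *)
Lemma is_derive_lineP (f : V -> R) x v df :
  is_derive x v f df <-> is_derive (0 : R) 1 (fun h => f (h *: v + x)) df.
Proof.
have E : (fun h : R => h^-1 *: (((fun h => f (h *: v +
  x)) \o shift 0) (h *: 1) - f (0 *: v + x))) =
   (fun h : R => h^-1 *: ((f \o shift x) (h *: v) - f x)).
  by apply/funext => h /=; rewrite addr0 scale0r add0r [h *: 1]mulr1.
by split => -[d D]; split; move: d D; rewrite /derivable /derive ?E // -?E.
Qed.

Lemma is_derive_comp_line (p : R -> R) (f : V -> R) x v dp df :
  is_derive (f x) 1 p dp -> is_derive x v f df ->
  is_derive x v (p \o f) (dp * df).
Proof.
move=> Hp Hf; apply/(is_derive_lineP (p \o f) x v).
have {}Hf := (is_derive_lineP f x v df).1 Hf.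
apply: (@is_derive1_comp _ p (fun h : R => f (h *: v + x))) => //.
by rewrite scale0r add0r.
Qed.

(** A recursion on the order, which makes stability under sums, products and composition an
    induction; [smooth] quantifies over sequences of directions instead. [Ck_smooth] and
    [test_function_Ck] link the two. *)
Fixpoint Ck (k : nat) (f : V -> R) : Prop :=
  continuous f /\
  if k is k'.+1 then forall i, (forall x, derivable f x (e i)) /\ Ck k'
    (partial i f) else True.

Lemma Ck_continuous k f : Ck k f -> continuous f.
Proof. by case: k => [|k] []. Qed.

Lemma Ck_is_derive k f i x : Ck k.+1 f -> is_derive x (e i) f (partial i f x).
Proof. by move=> [_ /(_ i) [d _]]; split => //; exact: d. Qed.

Lemma Ck_partial k f i : Ck k.+1 f -> Ck k (partial i f).
Proof. by move=> [_ /(_ i) []]. Qed.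

Lemma CkS k f : Ck k.+1 f -> Ck k f.
Proof.
elim: k f => [|k IH] f [cf H]; split => //= i.
have [d s] := H i; split => //; exact: IH.
Qed.

Lemma CkD k f g : Ck k f -> Ck k g -> Ck k (f + g).
Proof.
elim: k f g => [|k IH] f g [cf Hf] [cg Hg]; split => //=.
1,2: by move=> x; apply: (@continuousD _ _ _ f g); [exact: cf|exact: cg].
move=> i; have [df sf] := Hf i; have [dg sg] := Hg i.
split; first by move=> x; apply: derivableD.
have -> : partial i (f + g) = partial i f + partial i g by apply/funext => x;
  rewrite /partial deriveD.
exact: IH.
Qed.

Lemma CkM k f g : Ck k f -> Ck k g -> Ck k (f * g).
Proof.
elim: k f g => [|k IH] f g Hf Hg.
  move: Hf Hg => [cf _] [cg _]; split => // x.
  by apply: (@continuousM _ _ f g); [exact: cf|exact: cg].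
have [cf Hf'] := Hf; have [cg Hg'] := Hg; split => /=.
  by move=> x; apply: (@continuousM _ _ f g); [exact: cf|exact: cg].
move=> i; have [df sf] := Hf' i; have [dg sg] := Hg' i.
split; first by move=> x; apply: derivableM.
have -> : partial i (f * g) = f * partial i g + g * partial i f.
  by apply/funext => x; rewrite /partial deriveM.
by apply: CkD; apply: IH => //; apply: CkS.
Qed.

Lemma Ck_cst k a : Ck k (cst a).
Proof.
elim: k a => [|k IH] a; split => //=; try by move=> x; exact: cst_continuous.
move=> i; split; first by move=> x; have [] := is_derive_cst a x (e i).
have -> : partial i (cst a) = cst 0 by apply/funext => x; rewrite /partial derive_cst.
exact: IH.
Qed.

Lemma is_derive_coord (i j : 'I_n) (x : V) :
  is_derive x (e i) (fun x : V => x ord0 j) (i == j)%:R.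
Proof.
apply/(is_derive_lineP (fun x : V => x ord0 j) x (e i)).
have -> : (fun h : R => (h *: e i + x) ord0 j) =
  (fun h : R => h * (i == j)%:R) + cst (x ord0 j).
  by apply/funext => h; rewrite !mxE /= (eq_sym j).
have -> : (fun h : R => h * (i == j)%:R) = (i == j)%:R \*: (id : R -> R).
  by apply/funext => h; rewrite mulrC.
have := is_deriveD (is_deriveZ (i == j)%:R (is_derive_id (0 : R) 1))
  (is_derive_cst (x ord0 j) (0 : R) 1).
by rewrite addr0 [_ *: _]mulr1.
Qed.

Lemma Ck_coord k j : Ck k (fun x => x ord0 j).
Proof.
case: k => [|k]; split => //=; try exact: continuous_coord.
move=> i; split; first by move=> x; have [] := is_derive_coord i j x.
have -> : partial i (fun x : V => x ord0 j) = cst (i == j)%:R.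
  by apply/funext => x; have [_] := is_derive_coord i j x.
exact: Ck_cst.
Qed.

Lemma Ck_comp k (p : R -> R) f : smooth_upto k p -> Ck k f -> Ck k (p \o f).
Proof.
elim: k p f => [|k IH] p f sp Hf.
  split => // x; apply: (@continuous_comp _ _ _ f p).
    by have [cf _] := Hf; exact: cf.
  by have [cp _] := sp; exact: cp.
have [cp [dp sp']] := sp; have [cf Hf'] := Hf; split.
  by move=> x; apply: (@continuous_comp _ _ _ f p); [exact: cf|exact: cp].
move=> i; have [df sf] := Hf' i.
have D x : is_derive x (e i) (p \o f) (((derive1 p \o f) * partial i f) x).
  apply: is_derive_comp_line; last exact: DeriveDef.
  by apply: DeriveDef => //; rewrite /= derive1E.
split; first by move=> x; have [] := D x.
have -> : partial i (p \o f) = (derive1 p \o f) * partial i f.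
  by apply/funext => x; have [_] := D x.
by apply: CkM => //; apply: IH => //; exact: CkS.
Qed.

Lemma Ck_sum k (I : Type) (s : seq I) (f : I -> V -> R) :
  (forall i, Ck k (f i)) -> Ck k (fun x => \sum_(i <- s) f i x).
Proof.
move=> H; elim: s => [|i s IH].
  by under eq_fun do rewrite big_nil; exact: Ck_cst.
under eq_fun do rewrite big_cons.
exact: CkD.
Qed.

Lemma Ck_smooth f : (forall k, Ck k f) -> smooth f.
Proof.
(* In [foldr partial f s] the last direction of the sequence is applied first, so the induction
   peels off the end. *)
move=> H s; elim/last_ind: s f H => [|s i IH] f H.
  split; first exact: (Ck_continuous (H 0%N)).
  by move=> i x; have [_ /(_ i) []] := H 1%N.
by rewrite -cats1 foldr_cat /=; apply: IH => k; exact: Ck_partial.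
Qed.

Lemma partial_supported (f : V -> R) i (r : R) : supported f r ->
  supported (partial i f) r.
Proof.
move=> sf x xr; rewrite /partial.
rewrite (@near_eq_derive _ _ _ f (cst 0)) ?derive_cst//.
have o : open [set y : V | r < `|y|].
  have c : continuous (Num.norm : V -> R) by exact: norm_continuous.
  by move/continuousP : c => /(_ _ (@open_gt R r)).
apply: filterS (open_nbhs_nbhs (conj o xr)) => y /= yr.
exact: sf.
Qed.

Lemma supported_test_function (f : V -> R) (r : R) : (forall k, Ck k f) ->
  supported f r -> test_function f.
Proof.
move=> H sf; split; first exact: Ck_smooth.
apply: (subclosed_compact (@closed_closure _ _) (@compact_cube _ _ 0 r)).
rewrite [X in _ `<=` X](closure_id (cube 0 r)).1; last exact: closed_cube.
apply: closure_subset => x /= fx; rewrite /cube /= subr0 leNgt.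
by apply/negP => /sf; apply/eqP.
Qed.

Lemma test_function_Ck (psi : V -> R) : test_function psi -> forall k, Ck k psi.
Proof.
move=> [+ _] k; elim: k psi => [|k IH] psi s; split => //; try exact: (s [::]).1.
move=> i; split; first exact: (s [::]).2.
by apply: IH => t; have := s (rcons t i); rewrite -cats1 foldr_cat.
Qed.

Lemma test_function_supported (psi : V -> R) : test_function psi ->
  exists r, supported psi r.
Proof.
move=> [_ c]; have [M [_ HM]] := compact_bounded c; exists (M + 1) => x xM.
apply/eqP; apply: contraTT xM => px; rewrite -leNgt.
by apply: HM; [rewrite ltrDl|exact: subset_closure].
Qed.

End Ck.

(** * From the quadratic form to distributions *)

Section distributional.
Context (R : realType) (n : nat).
Local Notation V := 'rV[R]_n.
Local Notation mu := (lebesgue_rV R n).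
Local Open Scope complex_scope.

Lemma supportedMl (f g : V -> R) r : supported g r -> supported (f * g) r.
Proof. by move=> sg x xr; rewrite [LHS](_ : _ = f x * g x)// sg// mulr0. Qed.

Lemma supportedMr (f g : V -> R) r : supported f r -> supported (f * g) r.
Proof. by move=> sf x xr; rewrite [LHS](_ : _ = f x * g x)// sf// mul0r. Qed.

Lemma continuous_rVM (f g : V -> R) : continuous f -> continuous g ->
  continuous (f * g).
Proof. by move=> cf cg x; apply: (@continuousM _ _ f g); [exact: cf|exact: cg]. Qed.

Lemma Lfun_supported (u : V -> R) r : continuous u -> supported u r ->
  u \in Lfun mu 2%:E.
Proof.
move=> cu su; rewrite inE; apply/andP; split.
  by rewrite inE /=; exact: continuous_measurable_rV.
rewrite inE /= /finite_norm unlock poweR_lty//.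
have : (mu.-integrable setT (EFin \o (u * u))).
  by apply: (@integrable_supported _ _ _ r); [exact: continuous_rVM|exact: supportedMl].
move=> /integrableP[_]; apply: le_lt_trans.
rewrite le_eqVlt; apply/orP; left; apply/eqP.
by apply: eq_integral => x _ /=; rewrite mulrfctE normrM powR_mulrn.
Qed.

Lemma L2_real (u : V -> R) r : continuous u -> supported u r -> L2 (fun x => (u x)%:C).
Proof.
move=> cu su; split; first exact: Lfun_supported su.
by apply: (@Lfun_supported (cst 0) r) => //; exact: cst_continuous.
Qed.

Lemma ReD (a b : R[i]) : complex.Re (a + b) = complex.Re a + complex.Re b.
Proof. by case: a b => [? ?] []. Qed.

Lemma Re_sum (I : Type) (s : seq I) (f : I -> R[i]) :
  complex.Re (\sum_(i <- s) f i) = \sum_(i <- s) complex.Re (f i).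
Proof. by apply: (big_morph _ ReD). Qed.

Lemma complex_integral_real (f : V -> R) :
  complex_integral (fun x => (f x)%:C) = (\int[mu]_x f x)%:C.
Proof. by rewrite /complex_integral /= /Rintegral integral0. Qed.

Lemma continuous_partial (f : V -> R) i : Ck 1 f -> continuous (partial i f).
Proof. by move=> f1; exact: (Ck_continuous (Ck_partial i f1)). Qed.

Lemma integration_by_parts_rV (f g : V -> R) i r : Ck 1 f -> Ck 1 g -> supported f r ->
  \int[mu]_x (f x * partial i g x) = - \int[mu]_x (partial i f x * g x).
Proof.
move=> f1 g1 sf.
have sf' := partial_supported i sf.
have i1 : mu.-integrable setT (EFin \o (f * partial i g)).
  apply: (@integrable_supported _ _ _ r); last exact: supportedMr.
  by apply: continuous_rVM; [exact: Ck_continuous f1|exact: continuous_partial].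
have i2 : mu.-integrable setT (EFin \o (partial i f * g)).
  apply: (@integrable_supported _ _ _ r); last exact: supportedMr.
  by apply: continuous_rVM; [exact: continuous_partial|exact: Ck_continuous g1].
apply/eqP; rewrite -subr_eq0 opprK -[X in X + _]/(\int[mu]_x (f * partial i g) x).
rewrite -[X in _ + X]/(\int[mu]_x (partial i f * g) x) -RintegralD//.
suff Z : (\int[mu]_x ((f x * partial i g x + partial i f x * g x)%:E) = 0)%E.
  by rewrite /Rintegral Z.
apply: (@integral_partial_supported _ _ (f * g) _ i r).
- move=> x; apply: (@continuousD _ _ _ (f * partial i g) (partial i f * g)).
  + by apply: continuous_rVM; [exact: Ck_continuous f1|exact: continuous_partial].
  + by apply: continuous_rVM; [exact: continuous_partial|exact: Ck_continuous g1].
- move=> x; have := is_deriveM (Ck_is_derive i x f1) (Ck_is_derive i x g1).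
  by rewrite [g x *: _]mulrC.
- exact: supportedMr.
- by move=> x xr; rewrite (sf _ xr) (sf' _ xr) !mul0r addr0.
Qed.

Lemma weak_partial_real (f : V -> R) i : Ck 1 f ->
  weak_partial i (fun x => (f x)%:C) (fun x => (partial i f x)%:C).
Proof.
move=> f1 psi tpsi; have [r sr] := test_function_supported tpsi.
have p1 := test_function_Ck tpsi 1.
have -> : (fun x => (f x)%:C * (partial i psi x)%:C) =
  (fun x => (f x * partial i psi x)%:C).
  by apply/funext => x; rewrite rmorphM.
have -> : (fun x => (partial i f x)%:C * (psi x)%:C) =
  (fun x => (partial i f x * psi x)%:C).
  by apply/funext => x; rewrite rmorphM.
rewrite !complex_integral_real -rmorphN; congr (_%:C).
under eq_Rintegral do rewrite mulrC.
rewrite -[LHS]opprK -(integration_by_parts_rV _ p1 f1 sr).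
by congr (- _); apply: eq_Rintegral => x _; rewrite mulrC.
Qed.

Lemma H1_gradient_real (f : V -> R) r : Ck 1 f -> supported f r ->
  H1_gradient (fun x => (f x)%:C) (fun i x => (partial i f x)%:C).
Proof.
move=> f1 sf; split; first exact: L2_real (Ck_continuous f1) sf.
move=> i; split; last exact: weak_partial_real.
by apply: (@L2_real (partial i f) r);
  [exact: continuous_partial|exact: partial_supported].
Qed.

(** [rho] lies in the form domain and may be put in the form identity. The unknown weak gradient of
    [phi] then occurs only against [partial i rho], which is again a test function, so the
    definition of the weak derivative eliminates it. *)
Lemma schrodinger_distribution (q phi : V -> R) (E0 : R) (rho : V -> R) r :
  continuous q ->
  schrodinger q (fun x => (phi x)%:C) (fun x => (E0 * phi x)%:C) ->
  (forall k, Ck k rho) -> supported rho r ->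
  \int[mu]_x (q x * phi x * rho x) - \sum_i \int[mu]_x (phi x * partial i
    (partial i rho) x) =
  \int[mu]_x (E0 * phi x * rho x).
Proof.
move=> cq [[[gu Hu] _] _ H] Crho srho.
have HG := H1_gradient_real (Crho 1%N) srho.
have cs : continuous (fun x => Num.sqrt (q x)).
  by move=> x; apply: (@continuous_comp _ _ _ q Num.sqrt);
    [exact: cq|exact: sqrt_continuous].
have Drho : form_domain q (fun x => (rho x)%:C).
  split; first by exists (fun i x => (partial i rho x)%:C).
  have -> : (fun x => (Num.sqrt (q x))%:C * (rho x)%:C) =
            (fun x => (((fun x => Num.sqrt (q x)) * rho) x)%:C).
    by apply/funext => x; rewrite -rmorphM.
  apply: (@L2_real _ r); last exact: supportedMl.
  by apply: continuous_rVM => //; exact: Ck_continuous (Crho 0%N).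
have E := H gu _ _ Hu Drho HG.
have conjR (a : R) : Num.conj (a%:C : R[i]) = a%:C.
  by rewrite -[LHS]/(conjc a%:C) /= oppr0.
have K1 i : L2_dot (gu i) (fun x => (partial i rho x)%:C) =
   (- \int[mu]_x (phi x * partial i (partial i rho) x))%:C.
  rewrite /L2_dot (_ : (fun x => _) = (fun x => gu i x * (partial i rho x)%:C));
    last first.
    by apply/funext => x; rewrite conjR.
  have tp : test_function (partial i rho).
    by apply: (@supported_test_function _ _ _ r) => [k|];
      [exact: (Ck_partial i (Crho k.+1))|exact: partial_supported].
  have [_ /(_ i) [_ W]] := Hu.
  rewrite -[LHS]opprK -(W _ tp) [RHS]rmorphN /= -complex_integral_real;
    congr (- complex_integral _).
  by apply/funext => x; rewrite rmorphM.
have K2 : L2_dot (fun x => (q x)%:C * (phi x)%:C) (fun x => (rho x)%:C) =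
    (\int[mu]_x (q x * phi x * rho x))%:C.
  rewrite /L2_dot -complex_integral_real; congr complex_integral.
  by apply/funext => x; rewrite conjR !rmorphM.
have K3 : L2_dot (fun x => (E0 * phi x)%:C) (fun x => (rho x)%:C) =
    (\int[mu]_x (E0 * phi x * rho x))%:C.
  rewrite /L2_dot -complex_integral_real; congr complex_integral.
  by apply/funext => x; rewrite conjR -rmorphM.
move: E; rewrite /form_value (eq_bigr _ (fun i _ => K1 i)) K2 K3 => E.
have := congr1 (@complex.Re R) E; rewrite ReD Re_sum /= => <-.
by rewrite sumrN addrC.
Qed.

End distributional.

(** * The Laplacian *)

Section viscosity.
Context (R : realType) (n : nat).
Local Notation V := 'rV[R]_n.
Local Notation mu := (lebesgue_rV R n).
Local Notation e := (fun i : 'I_n => delta_mx ord0 i : V).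

Definition laplacian (f : V -> R) : V -> R := fun x => \sum_i partial i (partial i f) x.

Lemma laplacian_continuous f : Ck 2 f -> continuous (laplacian f).
Proof.
move=> f2; apply: (@Ck_continuous R n 0); apply: Ck_sum => i.
exact: (Ck_partial i (Ck_partial i f2)).
Qed.

Lemma laplacian_supported f r : supported f r -> supported (laplacian f) r.
Proof.
move=> sf x xr; rewrite /laplacian big1// => i _.
exact: (partial_supported i (partial_supported i sf)).
Qed.

Lemma Rintegral_mul_sum (u : V -> R) (v : 'I_n -> V -> R) r :
  continuous u -> (forall i, continuous (v i)) -> (forall i, supported (u * v i) r) ->
  \int[mu]_x (u x * \sum_i v i x) = \sum_i \int[mu]_x (u x * v i x).
Proof.
move=> cu cv suv; under eq_Rintegral do rewrite mulr_sumr.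
elim: (index_enum _) => [|i s IH].
  by rewrite big_nil; under eq_Rintegral do rewrite big_nil;
    rewrite /Rintegral integral0.
rewrite big_cons -IH; under eq_Rintegral do rewrite big_cons.
rewrite RintegralD//; apply: (@integrable_supported _ _ _ r).
+ exact: continuous_rVM.
+ exact: suv.
+ exact: (@Ck_sum R n 0 _ s (fun j => u * v j) (fun j =>
  conj (continuous_rVM cu (cv j)) I)).1.
+ by move=> x xr; rewrite big1// => j _; exact: suv.
Qed.

Lemma integral_mul_laplacian (f g : V -> R) r :
  continuous f -> Ck 2 g -> supported g r ->
  \int[mu]_x (f x * laplacian g x) =
    \sum_i \int[mu]_x (f x * partial i (partial i g) x).
Proof.
move=> cf g2 sg; apply: (@Rintegral_mul_sum f (fun i =>
  partial i (partial i g)) r) => //.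
- by move=> i; exact: (Ck_continuous (Ck_partial i (Ck_partial i g2))).
- by move=> i; apply: supportedMl;
  exact: (partial_supported i (partial_supported i sg)).
Qed.

(** Two integrations by parts. The support of [g] alone removes the boundary terms, so [f] may be a
    constant or a polynomial. *)
Lemma laplacian_symmetric (f g : V -> R) r : Ck 2 f -> Ck 2 g -> supported g r ->
  \int[mu]_x (f x * laplacian g x) = \int[mu]_x (laplacian f x * g x).
Proof.
move=> f2 g2 sg; rewrite (integral_mul_laplacian (Ck_continuous f2) g2 sg).
transitivity (\int[mu]_x (g x * laplacian f x)); last first.
  by apply: eq_Rintegral => x _; rewrite mulrC.
rewrite (@Rintegral_mul_sum g (fun i => partial i (partial i f)) r); last 3 first.
- exact: Ck_continuous g2.
- by move=> i; exact: (Ck_continuous (Ck_partial i (Ck_partial i f2))).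
- by move=> i; exact: supportedMr.
apply: eq_bigr => i _.
have g1 := Ck_partial i g2; have f1 := Ck_partial i f2.
have sg' := partial_supported i sg.
transitivity (\int[mu]_x (partial i (partial i g) x * f x)).
  by apply: eq_Rintegral => x _; rewrite mulrC.
rewrite -[LHS]opprK -(integration_by_parts_rV i g1 (CkS f2) sg').
rewrite -(integration_by_parts_rV i (CkS g2) f1 sg).
by [].
Qed.

(** By continuity f is at least f(x0) / 2 on a cube around x0, which has positive measure. *)
Lemma Rintegral_gt0 (f : V -> R) r x0 : continuous f -> supported f r ->
  (forall x, 0 <= f x) -> 0 < f x0 -> 0 < \int[mu]_x f x.
Proof.
move=> cf sf f0 fx0.
have int_f := integrable_supported cf sf.
have [d d0 Hd] : exists2 d, 0 < d & cube x0 d `<=` [set x | f x0 / 2 <= f x].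
  apply: near_cube.
  have h : f x0 / 2 < f x0 by rewrite ltr_pdivrMr// mulr_natr mulr2n ltrDl.
  by have := cf x0; move=> /cvgr_ge; apply.
have fin : (\int[mu]_x (f x)%:E)%E \is a fin_num by exact: integrable_fin_num.
rewrite /Rintegral -lte_fin fineK//.
apply: (@lt_le_trans _ _ (\int[mu]_(x in cube x0 d) (f x0 / 2)%:E)%E).
  rewrite integral_cst; last exact: measurable_cube.
  rewrite [X in (_ * X)%E](lebesgue_rV_cube x0 (ltW d0)) -EFinM lte_fin.
  by rewrite mulr_gt0 ?divr_gt0// exprn_gt0// mulrn_wgt0.
apply: (@le_trans _ _ (\int[mu]_(x in cube x0 d) (f x)%:E)%E).
  apply: ge0_le_integral.
  - exact: measurable_cube.
  - by move=> x _; rewrite lee_fin divr_ge0// ltW.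
  - exact: measurable_cst.
  - by apply: measurable_funTS; apply/measurable_EFinP; exact: continuous_measurable_rV.
  - by move=> x xd; rewrite lee_fin; exact: Hd.
apply: ge0_subset_integral.
- exact: measurable_cube.
- exact: measurableT.
- by apply/measurable_EFinP; exact: continuous_measurable_rV.
- by move=> x _; rewrite lee_fin.
- by [].
Qed.

End viscosity.

(** * Radial bumps and their derivative in the scale *)

Section radial.
Context (R : realType) (n : nat).
Local Notation V := 'rV[R]_n.
Local Notation mu := (lebesgue_rV R n).
Local Notation e := (fun i : 'I_n => delta_mx ord0 i : V).

(** The Euclidean distance is kept squared: this is a polynomial, smooth also at [x0]. *)
Definition sqdist (x0 : V) : V -> R := fun y => \sum_i (y ord0 i - x0 ord0 i) ^+ 2.

Lemma is_derive_diff (x0 y : V) i j :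
  is_derive y (e i) (fun y : V => y ord0 j - x0 ord0 j) (i == j)%:R.
Proof.
have := is_deriveB (is_derive_coord i j y) (is_derive_cst (x0 ord0 j) y (e i)).
by rewrite subr0.
Qed.

Lemma Ck_diff k (x0 : V) j : Ck k (fun y : V => y ord0 j - x0 ord0 j).
Proof. by apply: (CkD (@Ck_coord R n k j) (@Ck_cst R n k (- x0 ord0 j))). Qed.

Lemma Ck_sqdist k x0 : Ck k (sqdist x0).
Proof.
apply: Ck_sum => i; have := CkM (Ck_diff k x0 i) (Ck_diff k x0 i).
by congr Ck; apply/funext => y; rewrite expr2.
Qed.

Lemma is_derive_sqdist (x0 y : V) i :
  is_derive y (e i) (sqdist x0) (2 * (y ord0 i - x0 ord0 i)).
Proof.
have H := is_derive_sum (fun j =>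
  is_deriveM (is_derive_diff x0 y i j) (is_derive_diff x0 y i j)).
have <- : \sum_(j < n) ((y ord0 j - x0 ord0 j) *: ((i == j)%:R : R) +
  (y ord0 j - x0 ord0 j) *: ((i == j)%:R : R)) =
    2 * (y ord0 i - x0 ord0 i).
  rewrite (bigD1 i)//= big1 ?addr0 => [|j ji].
    rewrite eqxx /GRing.scale /=. ring.
  by rewrite eq_sym (negbTE ji) scaler0 addr0.
have <- : \sum_j ((fun y0 : V => y0 ord0 j - x0 ord0 j) * (fun y0 : V =>
  y0 ord0 j - x0 ord0 j)) = sqdist x0.
  apply/funext => z; rewrite /sqdist fct_sumE.
  by apply: eq_bigr => j _; rewrite expr2.
exact: H.
Qed.

Lemma sqdist_ge0 x0 y : 0 <= sqdist x0 y.
Proof. by apply: sumr_ge0 => i _; exact: sqr_ge0. Qed.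

Lemma sqdist_xx x0 : sqdist x0 x0 = 0.
Proof. by rewrite /sqdist big1// => i _; rewrite subrr expr0n. Qed.

Lemma sqr_norm_le_sqdist (x0 y : V) : `|y - x0| ^+ 2 <= sqdist x0 y.
Proof.
rewrite -[leRHS]sqr_sqrtr ?sqdist_ge0//; rewrite lerXn2r ?nnegrE ?sqrtr_ge0//.
apply/rV_norm_leP; first exact: sqrtr_ge0.
move=> i; rewrite -sqrtr_sqr ler_sqrt ?sqdist_ge0// !mxE /sqdist (bigD1 i)//= lerDl.
by apply: sumr_ge0 => j _; exact: sqr_ge0.
Qed.

Lemma smooth_upto_affine k (a b : R) : smooth_upto k (fun s : R => a + b * s).
Proof.
elim: k a b => [|k IH] a b; split => //=.
1,2: by move=> x; apply: cvgD; [exact: cvg_cst|apply: cvgMr; exact: cvg_id].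
have D (x : R) : is_derive x 1 (fun s => a + b * s) b.
  have := is_deriveD (is_derive_cst a x (1 : R)) (is_deriveZ b (is_derive_id x
    (1 : R))).
  by rewrite add0r [_ *: _]mulr1.
split; first by move=> x; have [] := D x.
have -> : derive1 (fun s => a + b * s) = (fun s => b + 0 * s).
  by apply/funext => x; rewrite derive1E mul0r addr0; have [_ ->] := D x.
exact: IH.
Qed.

Variable x0 : V.

(* The bump supported in the Euclidean ball of radius [tau^-1] around [x0]. *)
Definition rbump (tau : R) (k : nat) : V -> R :=
  fun y => exp_bump k (1 - tau ^+ 2 * sqdist x0 y).

Lemma Ck_rbump tau k j : Ck j (rbump tau k).
Proof.
have := Ck_comp (smooth_upto_exp_bump R j k) (Ck_comp (smooth_upto_affine j 1
  (- tau ^+ 2)) (Ck_sqdist j x0)).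
by congr Ck; apply/funext => y; rewrite /= mulNr.
Qed.

Lemma rbump_ge0 tau k y : 0 <= rbump tau k y.
Proof. exact: exp_bump_ge0. Qed.

Lemma rbump_eq0 tau k y : 0 < tau -> tau^-1 < `|y - x0| -> rbump tau k y = 0.
Proof.
move=> t0 h; apply: exp_bump_eq0; rewrite subr_le0.
apply: (@le_trans _ _ (tau ^+ 2 * `|y - x0| ^+ 2)); last first.
  by rewrite ler_wpM2l ?sqr_ge0// sqr_norm_le_sqdist.
rewrite -exprMn exprn_ege1// -(mulfV (lt0r_neq0 t0)) ler_wpM2l ?ltW//.
Qed.

Lemma rbump_supported tau k : 0 < tau -> supported (rbump tau k) (`|x0| + tau^-1).
Proof.
move=> t0 y h; apply: rbump_eq0 => //.
have := ler_normD (y - x0) x0; rewrite subrK => h2.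
by have := lt_le_trans h h2; rewrite addrC ltrD2r.
Qed.

Lemma is_derive_rbump tau k y i : is_derive y (e i) (rbump tau k)
  (- (2 * tau ^+ 2 * (y ord0 i - x0 ord0 i)) *
    (rbump tau k.+2 y - k%:R * rbump tau k.+1 y)).
Proof.
have D : is_derive y (e i) (fun y =>
  1 - tau ^+ 2 * sqdist x0 y) (- (2 * tau ^+ 2 * (y ord0 i - x0 ord0 i))).
  have := is_deriveB (is_derive_cst (1 : R) y (e i)) (is_deriveZ (tau ^+ 2)
    (is_derive_sqdist x0 y i)).
  congr is_derive; rewrite /GRing.scale /=; ring.
have := is_derive_comp_line (is_derive_exp_bump k (1 - tau ^+ 2 * sqdist x0 y)) D.
by rewrite mulrC.
Qed.

(** Index 0 is chosen so that the gradient has the single bump of index 2 as a factor;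
    differentiating that one brings in the indices 3 and 4. *)
Lemma laplacian_rbump tau y : laplacian (rbump tau 0) y =
  4 * tau ^+ 4 * sqdist x0 y * (rbump tau 4 y - 2 * rbump tau 3 y) -
  2 * n%:R * tau ^+ 2 * rbump tau 2 y.
Proof.
rewrite /laplacian.
transitivity (\sum_i (4 * tau ^+ 4 * (rbump tau 4 y - 2 * rbump tau 3 y) *
  (y ord0 i - x0 ord0 i) ^+ 2
   - 2 * tau ^+ 2 * rbump tau 2 y)); last first.
  rewrite big_split /= -mulr_sumr sumrN sumr_const card_ord -mulr_natr /sqdist. ring.
apply: eq_bigr => i _.
have -> : partial i (rbump tau 0) =
  (fun y => - (2 * tau ^+ 2)) * ((fun y : V => y ord0 i - x0 ord0 i) * rbump tau 2).
  apply/funext => z; have [_] := is_derive_rbump tau 0 z i.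
  rewrite /partial => ->; rewrite !mulrfctE mul0r subr0; ring.
have D := is_deriveM (is_derive_cst (- (2 * tau ^+ 2)) y (e i)) (is_deriveM
  (is_derive_diff x0 y i i) (is_derive_rbump tau 2 y i)).
have [_] := D; rewrite /partial => ->.
rewrite eqxx /GRing.scale /= /cst. ring.
Qed.

(** The weight tau^n compensates the shrinking of the support, so that the total mass does not
    depend on tau > 0 (see [rmean1_constant]). *)
Lemma is_derive_rbump_tau (tau : R) y : is_derive tau 1 (fun tau =>
  tau ^+ n * rbump tau 2 y)
  (n%:R * tau ^+ n.-1 * rbump tau 2 y -
   2 * tau ^+ n.+1 * sqdist x0 y * (rbump tau 4 y - 2 * rbump tau 3 y)).
Proof.
have Dn : is_derive tau 1 (fun t : R => t ^+ n) (n%:R * tau ^+ n.-1).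
  have := @is_deriveX _ _ (id : R -> R) n tau 1 1 (is_derive_id _ _).
  by rewrite exprfctE [_ *: _]mulr1.
have Dq : is_derive tau 1 (fun t : R =>
  1 - t ^+ 2 * sqdist x0 y) (- (2 * tau * sqdist x0 y)).
  have D2 : is_derive tau 1 (fun t : R => t ^+ 2) (2 * tau).
    have := @is_deriveX _ _ (id : R -> R) 2 tau 1 1 (is_derive_id _ _).
    by rewrite exprfctE [_ *: _]mulr1.
  have := is_deriveB (is_derive_cst (1 : R) tau (1 : R)) (is_deriveM D2
    (is_derive_cst (sqdist x0 y) tau (1 : R))).
  congr is_derive; rewrite /GRing.scale /= /cst; ring.
have Db := @is_derive1_comp _ (exp_bump 2) (fun t : R =>
  1 - t ^+ 2 * sqdist x0 y) tau _ _
  (is_derive_exp_bump 2 (1 - tau ^+ 2 * sqdist x0 y)) Dq.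
have := is_deriveM Dn Db.
congr is_derive; rewrite /GRing.scale /= /rbump (exprS tau n). ring.
Qed.

(** The kernel identity. With z = y - x0, both sides are tau^(n-1) times the divergence of z
    [rbump tau 2], and this field is the gradient of [rbump tau 0] divided by - 2 tau^2. *)
Lemma rbump_tau_laplacian tau y : 0 < tau ->
  n%:R * tau ^+ n.-1 * rbump tau 2 y -
   2 * tau ^+ n.+1 * sqdist x0 y * (rbump tau 4 y - 2 * rbump tau 3 y) =
  - (tau ^+ n / (2 * tau ^+ 3)) * laplacian (rbump tau 0) y.
Proof.
move=> t0; have tn0 : tau != 0 by rewrite gt_eqF.
(* Dimension 0 is separate because [n.-1] is then 0; the factor n cancels that term. *)
rewrite laplacian_rbump; case: n => [|m] /=; first by rewrite expr0 expr1; field.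
by rewrite !exprS; field.
Qed.

End radial.

(** * Radial means and viscosity *)

Section local_minimum.
Context (R : realType) (n : nat).
Local Notation V := 'rV[R]_n.
Local Notation mu := (lebesgue_rV R n).

Lemma continuous_bounded_cube (f : V -> R) c r : continuous f ->
  exists2 M, 0 <= M & forall x, cube c r x -> `|f x| <= M.
Proof.
move=> cf; have : compact (f @` cube c r).
  apply: continuous_compact; last exact: compact_cube.
  exact: continuous_subspaceT.
move=> /compact_bounded[M [_ HM]]; exists (`|M| + 1); first exact: addr_ge0.
move=> x xc; apply: HM; last by exists x.
by apply: (le_lt_trans (ler_norm M)); rewrite ltrDl.
Qed.

Variable x0 : V.

(** A weighted mean of [w] over the Euclidean ball of radius 1/tau around [x0], up to the
    normalising factor [rmean (cst 1) tau], which is constant for tau > 0. *)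
Definition rmean (w : V -> R) (tau : R) : R :=
  \int[mu]_y (w y * (tau ^+ n * rbump x0 tau 2 y)).

Lemma continuous_rbump tau k : continuous (rbump x0 tau k).
Proof. exact: (Ck_continuous (@Ck_rbump R n x0 tau k 0)). Qed.

Lemma continuous_rmean_integrand (w : V -> R) tau k : continuous w ->
  continuous (fun y => w y * (tau ^+ n * rbump x0 tau k y)).
Proof.
move=> cw; apply: (continuous_rVM cw); apply: (@continuous_rVM _ _ (cst (tau ^+ n))).
  by move=> x; exact: cst_continuous.
exact: continuous_rbump.
Qed.

Lemma supported_le (f : V -> R) r s : r <= s -> supported f r -> supported f s.
Proof. by move=> rs sf x xs; apply: sf; exact: le_lt_trans xs. Qed.

(** Differentiation under the integral sign. For t between tau / 2 and 2 tau the kernels live in one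
    cube, whose radius [r1] comes from the widest of them, and the derivatives are bounded there by
    a constant. *)
Lemma is_derive_rmean (w : V -> R) (tau : R) : continuous w -> 0 < tau ->
  is_derive tau 1 (rmean w)
    (- (tau ^+ n / (2 * tau ^+ 3)) * \int[mu]_y (w y * laplacian (rbump x0 tau 0) y)).
Proof.
move=> cw t0; pose r1 := `|x0| + (tau / 2)^-1.
have u0 : 0 < tau / 2 by rewrite divr_gt0.
have suppr t k : tau / 2 < t -> supported (rbump x0 t k) r1.
  move=> ut; have tt0 := lt_trans u0 ut.
  apply: (supported_le _ (@rbump_supported R n x0 t k tt0)).
  by rewrite lerD2l lef_pV2 ?posrE// ltW.
pose f t y := w y * (t ^+ n * rbump x0 t 2 y).
have rmeanE t : tau / 2 < t -> rmean w t = \int[mu]_(y in cube 0 r1) f t y.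
  move=> ut; rewrite /rmean /Rintegral (@integral_supported _ _ _ r1)// => y yr.
  by rewrite (suppr t 2 ut y yr) !mulr0.
have D (t : R) (y : V) : is_derive t 1 (f^~ y) (w y *
  (n%:R * t ^+ n.-1 * rbump x0 t 2 y -
   2 * t ^+ n.+1 * sqdist x0 y * (rbump x0 t 4 y - 2 * rbump x0 t 3 y))).
  have := is_deriveM (is_derive_cst (w y) t (1 : R)) (is_derive_rbump_tau x0 t y).
  by rewrite scaler0 addr0.
have d1E (t : R) (y : V) : partial1of2 f t y =
  w y * (n%:R * t ^+ n.-1 * rbump x0 t 2 y -
   2 * t ^+ n.+1 * sqdist x0 y * (rbump x0 t 4 y - 2 * rbump x0 t 3 y)).
  by rewrite /partial1of2 derive1E; have [_ ->] := D t y.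
have [W W0 HW] := continuous_bounded_cube 0 r1 cw.
have [S S0 HS] := continuous_bounded_cube 0 r1 (Ck_continuous (@Ck_sqdist R n 0 x0)).
pose v := tau * 2.
(* Termwise bound of the derivative: [W] for w, [S] for the squared distance, [v] for t, and the
   factorials of [exp_bump_le] for the bumps. *)
pose G := W * (n%:R * v ^+ n.-1 * 2`!%:R + 2 * v ^+ n.+1 * S * (4`!%:R + 2 * 3`!%:R)).
have G0 : 0 <= G.
  have v0 k : 0 <= v ^+ k by rewrite exprn_ge0// mulr_ge0// ltW.
  by do ?[apply: mulr_ge0 => //|apply: addr_ge0 => //].
have rb_le t k y : `|rbump x0 t k y| <= k`!%:R.
  by rewrite ger0_norm ?rbump_ge0//; exact: exp_bump_le.
have hyps : [/\ (`]tau / 2, v[%classic : set R) tau,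
    forall x, (`]tau / 2, v[%classic : set R) x ->
      mu.-integrable (cube 0 r1) (EFin \o f x),
    forall x y, (`]tau / 2, v[%classic : set R) x -> cube 0 r1 y ->
      derivable (f^~ y) x 1,
    mu.-integrable (cube 0 r1) (EFin \o (fun=> G)) &
    forall x y, (`]tau / 2, v[%classic : set R) x -> cube 0 r1 y ->
      `|partial1of2 f x y| <= G].
  split.
  - by rewrite /= in_itv /= /v; apply/andP; split; lra.
  - by move=> t _; apply: continuous_integrable_cube; exact: continuous_rmean_integrand.
  - by move=> t y _ _; have [] := D t y.
  - by apply: (@continuous_integrable_cube _ _ (fun=> G)); exact: cst_continuous.
  - move=> t y; rewrite /= in_itv /= => /andP[ut tv] yr.
    have tt0 : 0 < t := lt_trans u0 ut.
    have powle k : t ^+ k <= v ^+ k by rewrite lerXn2r ?nnegrE ?ltW// (lt_trans tt0).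
    rewrite d1E normrM /G ler_pM//; first exact: HW.
    apply: le_trans (ler_normB _ _) _; apply: lerD.
      rewrite !normrM (ger0_norm (ltW (exprn_gt0 _ tt0))) ger0_norm//.
      by rewrite ler_pM ?mulr_ge0 ?exprn_ge0 ?(ltW tt0)// ler_wpM2l.
    rewrite !normrM (ger0_norm (ltW (exprn_gt0 _ tt0))) (ger0_norm (ler0n _ 2)).
    apply: ler_pM => //.
    + by rewrite !mulr_ge0// exprn_ge0// ltW.
    + apply: ler_pM => //; first by rewrite mulr_ge0// exprn_ge0// ltW.
        by rewrite ler_wpM2l.
      exact: HS.
    + apply: le_trans (ler_normB _ _) _; apply: lerD => //.
      by rewrite normrM ger0_norm// ler_wpM2l.
have [h1 h2 h3 h4 h5] := hyps.
have dF := derivable_under_integral (measurable_cube 0 r1) h1 h2 h3 (fun=> G0) h4 h5.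
have dE := differentiation_under_integral (measurable_cube 0 r1) h1 h2 h3
  (fun=> G0) h4 h5.
apply: (@near_eq_is_derive _ _ _ (fun t => \int[mu]_(y in cube 0 r1) f t y)).
  near=> t; apply/esym/rmeanE; near: t; apply: lt_nbhsr; lra.
split => //; rewrite -derive1E dE.
have lap_s : supported (laplacian (rbump x0 tau 0)) r1.
  by apply: laplacian_supported; apply: suppr; lra.
have lap_c : continuous (fun y => w y * laplacian (rbump x0 tau 0) y).
  by apply: (continuous_rVM cw); apply: laplacian_continuous; exact: Ck_rbump.
rewrite [X in _ = _ * X](_ : _ =
  \int[mu]_(y in cube 0 r1) (w y * laplacian (rbump x0 tau 0) y)); last first.
  by rewrite /Rintegral (@integral_supported _ _ _ r1)//; exact: supportedMl.
rewrite -RintegralZl//; last 2 first.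
- exact: measurable_cube.
- exact: continuous_integrable_cube.
apply: eq_Rintegral => y _; rewrite d1E rbump_tau_laplacian//; ring.
Unshelve. all: by end_near. Qed.

Lemma rmean_ge0 (w : V -> R) tau : 0 < tau ->
  (forall y, cube x0 tau^-1 y -> 0 <= w y) -> 0 <= rmean w tau.
Proof.
move=> t0 w0; apply: Rintegral_ge0 => y _.
have [h|h] := leP `|y - x0| tau^-1; last by rewrite rbump_eq0// !mulr0.
by rewrite mulr_ge0 ?w0// mulr_ge0 ?rbump_ge0// exprn_ge0// ltW.
Qed.

(** The derivative is a multiple of the integral of a compactly supported Laplacian, which vanishes
    on moving the Laplacian to the constant 1. This replaces a change of variables. *)
Lemma rmean1_constant a b : 0 < a -> a < b -> rmean (cst 1) a = rmean (cst 1) b.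
Proof.
move=> a0 ab.
have c1 : continuous (cst 1 : V -> R) by exact: cst_continuous.
have D (t : R) : 0 < t -> is_derive t 1 (rmean (cst 1)) 0.
  move=> t0; have := is_derive_rmean c1 t0.
  rewrite (laplacian_symmetric (@Ck_cst R n 2 1) (@Ck_rbump R n x0 t 0 2)
    (@rbump_supported R n x0 t 0 t0)).
  rewrite [X in _ * X](_ : _ = 0) ?mulr0//.
  rewrite /Rintegral integral0_eq// => y _.
  rewrite /laplacian big1 ?mul0r// => i _.
  have -> : partial i (cst 1 : V -> R) = cst 0 by apply/funext => x;
    rewrite /partial derive_cst.
  by rewrite /partial derive_cst.
have [] := @MVT _ (rmean (cst 1)) (fun=> 0) a b ab.
- by move=> t; rewrite in_itv /= => /andP[at_ _]; apply: D; exact: lt_trans at_.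
- apply: derivable_within_continuous => t; rewrite in_itv /= => /andP[at_ _].
  by have [] := D t (lt_le_trans a0 at_).
- by move=> c _; rewrite mul0r => /subr0_eq ->.
Qed.

(* The means of [w] over the balls of radius [tau^-1] would increase with [tau]
   although they tend to the minimum. *)
Lemma no_local_minimum (w g : V -> R) r0 :
  continuous w -> continuous g -> 0 < r0 ->
  (forall y, cube x0 r0 y -> 0 <= w y) -> w x0 = 0 ->
  (forall y, cube x0 r0 y -> g y < 0) ->
  (forall rho r, (forall k, Ck k rho) -> supported rho r -> (forall x, 0 <= rho x) ->
    \int[mu]_y (w y * laplacian rho y) = \int[mu]_y (g y * rho y)) -> False.
Proof.
move=> cw cg r00 w0 wx0 g0 H.
(* For t >= a the kernel at scale t lives in the cube of radius 1/t < r0, where the signs of [w] and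
   [g] are known. *)
pose a := r0^-1 + 1.
have ia0 : 0 < r0^-1 by rewrite invr_gt0.
have a0 : 0 < a by rewrite addr_gt0.
have cube_sub t : a <= t -> cube x0 t^-1 `<=` cube x0 r0.
  move=> at_ y /le_trans; apply; rewrite -[r0]invrK lef_pV2 ?posrE ?invr_gt0//.
    by rewrite (le_trans _ at_)// lerDl.
  exact: lt_le_trans at_.
have U0 t : a <= t -> 0 <= rmean w t.
  by move=> at_; apply: rmean_ge0 => [|y /(cube_sub _ at_)/w0//];
    exact: lt_le_trans at_.
have D (t : R) : 0 < t -> is_derive t 1 (rmean w) (- (t ^+ n /
  (2 * t ^+ 3)) * \int[mu]_y (g y * rbump x0 t 0 y)).
  move=> t0; have := is_derive_rmean cw t0.
  rewrite (H _ (`|x0| + t^-1))//.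
  - by move=> k; exact: Ck_rbump.
  - exact: rbump_supported.
  - by move=> y; exact: rbump_ge0.
(* [g] is negative on the support of the bump, and the bump is positive at [x0]. *)
have Dpos t : a <= t -> 0 < - (t ^+ n / (2 * t ^+ 3)) * \int[mu]_y
  (g y * rbump x0 t 0 y).
  move=> at_; have t0 : 0 < t := lt_le_trans a0 at_.
  rewrite mulNr -mulrN mulr_gt0 ?divr_gt0 ?mulr_gt0 ?exprn_gt0//.
  rewrite -[X in 0 < - X]mul1r -mulNr -RintegralZl//; last first.
    apply: (@integrable_supported _ _ (g * rbump x0 t 0) (`|x0| + t^-1)).
      by apply: continuous_rVM => //; exact: continuous_rbump.
    by apply: supportedMl; exact: rbump_supported.
  apply: (@Rintegral_gt0 _ _ _ (`|x0| + t^-1) x0).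
  - apply: (@continuous_rVM _ _ (cst (-1)) (g * rbump x0 t 0));
    first exact: cst_continuous.
    by apply: continuous_rVM => //; exact: continuous_rbump.
  - by move=> y yr; rewrite rbump_supported// !mulr0.
  - move=> y; have [h|h] := leP `|y - x0| t^-1; last by rewrite rbump_eq0// !mulr0.
    by rewrite mulN1r -mulNr mulr_ge0 ?rbump_ge0// oppr_ge0 ltW// g0//;
      exact: cube_sub h.
  - rewrite mulN1r -mulNr mulr_gt0 ?oppr_gt0 ?g0//.
      by rewrite /cube /= subrr normr0 ltW.
    by apply: exp_bump_gt0; rewrite sqdist_xx mulr0 subr0.
have Uinc s t : a <= s -> s < t -> rmean w s < rmean w t.
  move=> as_ st; have [] := @MVT _ (rmean w) (fun t =>
    - (t ^+ n / (2 * t ^+ 3)) * \int[mu]_y (g y * rbump x0 t 0 y)) s t st.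
  - by move=> c; rewrite in_itv /= => /andP[sc _]; apply: D; apply: lt_trans sc;
    exact: lt_le_trans as_.
  - apply: derivable_within_continuous => c; rewrite in_itv /= => /andP[sc _].
    by have [] := D c (lt_le_trans a0 (le_trans as_ sc)).
  - move=> c; rewrite in_itv /= => /andP[sc _] E.
    by rewrite -subr_gt0 E mulr_gt0 ?subr_gt0// Dpos// (le_trans as_)// ltW.
pose eta := rmean w (a + 1).
have eta0 : 0 < eta by rewrite (le_lt_trans (U0 a _))// Uinc// ltrDl.
pose M := rmean (cst 1) a.
have M0 : 0 <= M by apply: rmean_ge0.
(* Then ep M < eta. The 1 is added because M is only known to be nonnegative. *)
pose ep := eta / (M + 1).
have M1 : 0 < M + 1 := ltr_wpDl M0 ltr01.
have ep0 : 0 < ep := divr_gt0 eta0 M1.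
have [d d0 Hd] : exists2 d, 0 < d & cube x0 d `<=` [set x | w x <= ep].
  apply: near_cube.
  by have := cw x0; rewrite /continuous_at wx0 => /cvgr_le; apply.
(* Beyond a + 1 the mean exceeds [eta]; but 1/t < d, so w <= ep on the support and the mean is at
   most ep M < eta. *)
pose t := a + 1 + d^-1 + 1.
have id0 : 0 < d^-1 by rewrite invr_gt0.
have at_ : a + 1 < t by rewrite /t; lra.
have t0 : 0 < t by apply: lt_trans at_; rewrite addr_gt0.
have lt1 : eta < rmean w t by apply: Uinc => //; rewrite lerDl.
have cint (u : V -> R) : continuous u ->
    mu.-integrable setT (EFin \o (fun y => u y * (t ^+ n * rbump x0 t 2 y))).
  move=> cu; apply: (@integrable_supported _ _ _ (`|x0| + t^-1)).
    exact: continuous_rmean_integrand.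
  by move=> y yr; rewrite rbump_supported// !mulr0.
have : rmean w t <= ep * M.
  have -> : M = rmean (cst 1) t by apply: rmean1_constant => //;
    rewrite (lt_trans _ at_)// ltrDl.
  rewrite /rmean -RintegralZl//; last by apply: cint; exact: cst_continuous.
  apply: le_Rintegral => //.
  - exact: cint.
  - have := cint (cst ep) (@cst_continuous _ _ ep).
    congr (integrable _ _ _); apply/funext => y /=; by rewrite /cst mul1r.
  - move=> y _; rewrite /cst mul1r.
    have [h|h] := leP `|y - x0| t^-1; last by rewrite rbump_eq0// !mulr0.
    rewrite ler_wpM2r ?mulr_ge0 ?rbump_ge0 ?exprn_ge0 ?(ltW t0)//.
    apply: Hd; apply: le_trans h _; rewrite -[d]invrK lef_pV2 ?posrE ?invr_gt0//.
    by rewrite /t; lra.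
move=> /(lt_le_trans lt1); rewrite /ep mulrAC (ltr_pdivlMr _ _ M1) mulrDr mulr1.
by rewrite gtrDl ltNge (ltW eta0).
Qed.

(** If the conclusion failed, [phi - P] would have a local minimum at [x0] while its distributional
    Laplacian [h - laplacian P] is negative nearby, against [no_local_minimum]. *)
Lemma viscosity_supersolution (phi h P : V -> R) r0 :
  continuous phi -> continuous h -> Ck 2 P -> 0 < r0 ->
  (forall y, cube x0 r0 y -> P y <= phi y) -> P x0 = phi x0 ->
  (forall rho r, (forall k, Ck k rho) -> supported rho r -> (forall x, 0 <= rho x) ->
    \int[mu]_y (phi y * laplacian rho y) = \int[mu]_y (h y * rho y)) ->
  laplacian P x0 <= h x0.
Proof.
move=> cphi ch cP r00 Pphi Px0 H; rewrite leNgt; apply/negP => hP.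
have cl := laplacian_continuous cP.
have cB (u v : V -> R) : continuous u -> continuous v -> continuous (u - v).
  by move=> cu cv x; apply: (@continuousB _ _ _ u v); [exact: cu|exact: cv].
have [d d0 Hd] : exists2 d, 0 < d & cube x0 d `<=` [set x | (h - laplacian P) x < 0].
  apply: near_cube; have := cB _ _ ch cl x0 => /cvgr_lt; apply.
  by rewrite [X in X < 0](_ : _ = h x0 - laplacian P x0)// subr_lt0.
have m0 : 0 < Num.min r0 d by rewrite lt_min r00.
apply: (@no_local_minimum (phi - P) (h - laplacian P) (Num.min r0 d)) => //.
- exact: cB (Ck_continuous cP).
- exact: cB.
- by move=> y yc; rewrite subr_ge0; apply: Pphi; apply: le_trans yc _;
  rewrite ge_min lexx.
- by rewrite [LHS](_ : _ = phi x0 - P x0)// Px0 subrr.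
- by move=> y yc; apply: Hd; apply: le_trans yc _; rewrite ge_min lexx orbT.
move=> rho r Crho srho rho0.
have cr := Ck_continuous (Crho 0%N).
have cint (u v : V -> R) : continuous u -> continuous v -> supported v r ->
   mu.-integrable setT (EFin \o (u * v)).
  by move=> cu cv sv; apply: (@integrable_supported _ _ _ r);
    [exact: continuous_rVM|exact: supportedMl].
have clr := laplacian_continuous (Crho 2%N).
have slr := laplacian_supported srho.
transitivity (\int[mu]_y (phi y * laplacian rho y - P y * laplacian rho y)).
  by apply: eq_Rintegral => y _; rewrite -mulrBl.
transitivity (\int[mu]_y (h y * rho y - laplacian P y * rho y)); last first.
  by apply: eq_Rintegral => y _; rewrite -mulrBl.
rewrite RintegralB//; [|exact: (cint phi _ cphi clr slr)|exact: (cint P _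
  (Ck_continuous cP) clr slr)].
rewrite RintegralB//; [|exact: (cint h _ ch cr srho)|exact: (cint
  (laplacian P) _ cl cr srho)].
by rewrite (H _ r)// (laplacian_symmetric cP (Crho 2%N) srho).
Qed.

End local_minimum.

(** * Comparison with a radial barrier *)

Section comparison.
Context (R : realType).

(** A Peano form of Taylor's formula: [K1] is differentiable at the single point [s0], so the error
    is absorbed in kappa instead of an intermediate second derivative. *)
Lemma taylor2_lower (K K1 : R -> R) (K2 s0 kappa : R) :
  (\forall s \near s0, is_derive (s : R) 1 K (K1 s)) -> is_derive s0 1 K1 K2 ->
    0 < kappa ->
  \forall s \near s0, K s0 + K1 s0 * (s - s0) + (K2 / 2 - kappa) * (s - s0) ^+ 2 <= K s.
Proof.
move=> dK dK1 k0.
(* The difference quotients of [K1] are eventually at least K2 - 2 kappa; multiplied by (s - s0)^2,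
   this holds on both sides of [s0] and at [s0]. *)
have H : \forall s \near s0, (s - s0) * (K1 s - K1 s0 - (K2 - 2 * kappa) *
  (s - s0)) >= 0.
  have [d1 D1] := dK1.
  have c : h^-1 *: ((K1 \o shift s0) (h *: (1 : R)) - K1 s0) @[h --> (0 : R)^'] --> K2.
    by rewrite -D1; exact: d1.
  have lt : K2 - 2 * kappa < K2 by lra.
  have : \forall h \near (0 : R)^', K2 - 2 * kappa <= h^-1 *: ((K1 \o shift s0)
    (h *: (1 : R)) - K1 s0).
    exact: (cvgr_ge _ c _ lt).
  move=> /nbhs_ballP[d /= d0 Hd]; apply/nbhs_ballP; exists d => //= s.
  rewrite -ball_normE /= => sd.
  have [->|ss0] := eqVneq s s0; first by rewrite subrr mul0r.
  have h0 : s - s0 != 0 by rewrite subr_eq0.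
  have := Hd (s - s0); rewrite -ball_normE /= sub0r normrN distrC => /(_ sd h0).
  rewrite [_ *: 1]mulr1 subrK => H1.
  set A := K1 s - K1 s0 in H1 *.
  have -> : (s - s0) * (A - (K2 - 2 * kappa) * (s - s0)) =
    (s - s0) ^+ 2 * ((s - s0)^-1 *: A - (K2 - 2 * kappa)).
    by rewrite /GRing.scale /=; field.
  by rewrite mulr_ge0 ?sqr_ge0// subr_ge0.
have : \forall s \near s0, is_derive (s : R) 1 K (K1 s) /\
    0 <= (s - s0) * (K1 s - K1 s0 - (K2 - 2 * kappa) * (s - s0)) by exact: filterI.
move=> /nbhs_ballP[d /= d0 Hd].
apply/nbhs_ballP; exists d => //= s; rewrite -ball_normE /= => sd.
(* By [H] the product of t - s0 and the derivative of [G] is nonnegative near [s0], so [G] is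
   minimal there; the mean value theorem is applied on each side. *)
pose G t := K t - (K1 s0 * (t - s0) + (K2 / 2 - kappa) * (t - s0) ^+ 2).
have dG t : `|s0 - t| < d -> is_derive (t : R) 1 G (K1 t - K1 s0 -
  (K2 - 2 * kappa) * (t - s0)).
  move=> td; have [dKt _] : is_derive (t : R) 1 K
    (K1 t) /\ _ := Hd t ltac:(by rewrite -ball_normE).
  have dt : is_derive (t : R) 1 (fun t : R => t - s0) 1.
    by have := is_deriveB (is_derive_id t (1 : R)) (is_derive_cst s0 t (1 : R));
      rewrite subr0.
  have := is_deriveB dKt (is_deriveD (is_deriveZ (K1 s0) dt) (is_deriveZ
    (K2 / 2 - kappa) (is_deriveM dt dt))).
  have -> : G = K - (K1 s0 \*: (fun t : R => t - s0) +
      (K2 / 2 - kappa) \*: ((fun t : R => t - s0) * (fun t : R => t - s0))).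
    by apply/funext => u; rewrite /G expr2.
  by congr is_derive; rewrite /GRing.scale /=; field.
suff : G s0 <= G s by rewrite /G subrr mulr0 expr0n mulr0 addr0 subr0 lerBrDr addrA.
have [ss|ss|->] := ltgtP s0 s; last by [].
- have [||c] := @MVT _ G (fun t => K1 t - K1 s0 - (K2 - 2 * kappa) * (t - s0)) s0 s ss.
  + move=> t; rewrite in_itv /= => /andP[t1 t2]; apply: dG.
    by apply: le_lt_trans sd; rewrite !ltr0_norm ?subr_lt0// lerN2 lerD2l lerN2 ltW.
  + apply: derivable_within_continuous => t; rewrite in_itv /= => /andP[t1 t2].
    suff X : `|s0 - t| < d by have [] := dG t X.
    by apply: le_lt_trans sd; rewrite !ler0_norm ?subr_le0 ?(ltW ss)// lerN2 lerD2l
      lerN2.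
  + rewrite in_itv /= => /andP[c1 c2] E; rewrite -subr_ge0 E; apply: mulr_ge0;
    last by rewrite subr_ge0 ltW.
    have cd : `|s0 - c| < d.
      by apply: le_lt_trans sd; rewrite !ltr0_norm ?subr_lt0// lerN2 lerD2l lerN2 ltW.
    have [_ ] := Hd c ltac:(by rewrite -ball_normE).
    have c0 : 0 < c - s0 by rewrite subr_gt0.
    by rewrite (pmulr_rge0 _ c0).
- have [||c] := @MVT _ G (fun t => K1 t - K1 s0 - (K2 - 2 * kappa) * (t - s0)) s s0 ss.
  + move=> t; rewrite in_itv /= => /andP[t1 t2]; apply: dG.
    by apply: le_lt_trans sd; rewrite !gtr0_norm ?subr_gt0// lerD2l lerN2 ltW.
  + apply: derivable_within_continuous => t; rewrite in_itv /= => /andP[t1 t2].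
    suff X : `|s0 - t| < d by have [] := dG t X.
    by apply: le_lt_trans sd; rewrite !ger0_norm ?subr_ge0 ?(ltW ss)// lerD2l lerN2.
  + rewrite in_itv /= => /andP[c1 c2] E; rewrite -subr_le0 E.
    have cd : `|s0 - c| < d.
      by apply: le_lt_trans sd; rewrite !gtr0_norm ?subr_gt0// lerD2l lerN2 ltW.
    have [_ ] := Hd c ltac:(by rewrite -ball_normE).
    have c0 : c - s0 < 0 by rewrite subr_lt0.
    rewrite (nmulr_rge0 _ c0) => X; by rewrite mulr_le0_ge0// subr_ge0 ltW.
Qed.

Context (n : nat).
Local Notation V := 'rV[R]_n.
Local Notation mu := (lebesgue_rV R n).
Local Notation e := (fun i : 'I_n => delta_mx ord0 i : V).
Local Notation sq := (@sqdist R n 0).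

Definition radial_quadratic (s0 a b c : R) : V -> R :=
  fun y => a + b * (sq y - s0) + c * (sq y - s0) ^+ 2.

Lemma Ck_radial_quadratic k s0 a b c : Ck k (radial_quadratic s0 a b c).
Proof.
have Cs : Ck k (fun y => sq y - s0) := CkD (Ck_sqdist k 0) (Ck_cst n k (- s0)).
have := CkD (CkD (Ck_cst n k a) (CkM (Ck_cst n k b) Cs)) (CkM (Ck_cst n k c)
  (CkM Cs Cs)).
by congr Ck; apply/funext => y; rewrite /radial_quadratic expr2.
Qed.

(** The Laplacian of u(|x|^2) is 4 s u''(s) + 2 n u'(s) at s = |x|^2; here u' = b and u'' = 2 c at
    s0. *)
Lemma laplacian_radial_quadratic s0 a b c x : sq x = s0 ->
  laplacian (radial_quadratic s0 a b c) x = 8 * s0 * c + 2 * n%:R * b.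
Proof.
move=> sx; rewrite /laplacian.
transitivity (\sum_i (8 * c * (x ord0 i - (0 : V) ord0 i) ^+ 2 + 2 * b)); last first.
  rewrite big_split /= -mulr_sumr sumr_const card_ord -mulr_natr.
  have -> : \sum_i (x ord0 i - (0 : V) ord0 i) ^+ 2 = s0 by exact: sx.
  ring.
apply: eq_bigr => i _.
have Ds (y : V) : is_derive y (e i) (fun y =>
  sq y - s0) (2 * (y ord0 i - (0 : V) ord0 i)).
  by have := is_deriveB (is_derive_sqdist 0 y i) (is_derive_cst s0 y (e i));
    rewrite subr0.
have -> : partial i (radial_quadratic s0 a b c) =
   (fun y : V => y ord0 i - (0 : V) ord0 i) * (cst (2 * b) +
     cst (4 * c) * (fun y => sq y - s0)).
  apply/funext => y.
  have D := is_deriveD (is_deriveD (is_derive_cst a y (e i)) (is_deriveZ b (Ds y)))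
     (is_deriveZ c (is_deriveM (Ds y) (Ds y))).
  have -> : radial_quadratic s0 a b c = cst a + b \*: (fun y => sq y - s0) +
    c \*: ((fun y => sq y - s0) * (fun y => sq y - s0)).
    by apply/funext => z; rewrite /radial_quadratic expr2.
  have [_] := D; rewrite /partial => ->.
  rewrite !fctE /GRing.scale /=; ring.
have D := is_deriveM (is_derive_diff 0 x i i) (is_deriveD (is_derive_cst (2 * b) x
  (e i)) (is_deriveM (is_derive_cst (4 * c) x (e i)) (Ds x))).
have [_] := D; rewrite /partial => ->.
rewrite eqxx !fctE /GRing.scale /= sx; ring.
Qed.

Variables phi h : V -> R.
Hypotheses (cphi : continuous phi) (ch : continuous h).
Hypothesis lap_phi : forall rho r, (forall k, Ck k rho) -> supported rho r ->
  (forall x, 0 <= rho x) ->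
  \int[mu]_y (phi y * laplacian rho y) = \int[mu]_y (h y * rho y).

Lemma radial_viscosity (K K1 : R -> R) (K2 : R) (x : V) : 0 < sq x ->
  (\forall s \near sq x, is_derive (s : R) 1 K (K1 s)) -> is_derive (sq x) 1 K1 K2 ->
  (\forall y \near x, K (sq y) <= phi y) -> K (sq x) = phi x ->
  4 * sq x * K2 + 2 * n%:R * K1 (sq x) <= h x.
Proof.
move=> s0 dK dK1 Kphi Kx; apply/ler_addgt0Pr => ep ep0.
(* Lowering the quadratic coefficient by kappa lowers the Laplacian by 8 s kappa = ep. *)
pose kappa := ep / (8 * sq x).
have k0 : 0 < kappa by rewrite divr_gt0// mulr_gt0.
have T := taylor2_lower dK dK1 k0.
have csq : continuous sq := Ck_continuous (Ck_sqdist 0 (0 : V)).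
have : \forall y \near x, radial_quadratic (sq x) (K (sq x)) (K1 (sq x))
  (K2 / 2 - kappa) y <= phi y.
  have T' := csq x _ T; near=> y.
  apply: (@le_trans _ _ (K (sq y))); first by near: y; exact: T'.
  by near: y.
move=> /near_cube[r0 r00 Hr].
have := @viscosity_supersolution R n x phi h (radial_quadratic (sq x) (K (sq x))
  (K1 (sq x)) (K2 / 2 - kappa))
  r0 cphi ch (Ck_radial_quadratic 2 _ _ _ _).
rewrite (laplacian_radial_quadratic _ _ _ (erefl (sq x))) => H.
have : 8 * sq x * (K2 / 2 - kappa) + 2 * n%:R * K1 (sq x) <= h x.
  apply: H => //.
  by rewrite /radial_quadratic subrr mulr0 expr0n mulr0 !addr0.
have -> : 8 * sq x * (K2 / 2 - kappa) = 4 * sq x * K2 - ep.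
  by rewrite /kappa; field; rewrite gt_eqF.
lra.
Unshelve. all: by end_near. Qed.

(* Subtracting the constant [E s2] keeps the barrier a subsolution and makes it
   vanish on the outer sphere, so that no decay of [phi] has to be known. *)
Lemma radial_comparison (E E1 E2 : R -> R) (s1 s2 c : R) : 0 < s1 -> s1 < s2 -> 0 < c ->
  (forall x, 0 < phi x) ->
  (forall s, s1 <= s -> is_derive (s : R) 1 E (E1 s)) ->
  (forall s, s1 < s -> is_derive (s : R) 1 E1 (E2 s)) ->
  0 <= E s2 ->
  (forall x, sq x = s1 -> c * E s1 <= phi x) ->
  (forall x, s1 < sq x -> phi x <= c * E (sq x) ->
    h x < c * (4 * sq x * E2 (sq x) + 2 * n%:R * E1 (sq x))) ->
  forall x, s1 <= sq x -> sq x <= s2 -> c * (E (sq x) - E s2) <= phi x.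
Proof.
move=> s10 s12 c0 phi0 dE dE1 Es2 bdry sub.
have csq : continuous sq := Ck_continuous (Ck_sqdist 0 (0 : V)).
pose A : set V := sq @^-1` `[s1, s2]%classic.
have cA : compact A.
  apply: (subclosed_compact _ (@compact_cube _ _ 0 (Num.sqrt s2))).
    by move/continuous_closedP : csq; apply; exact: interval_closed.
  move=> x; rewrite /A /= in_itv /= => /andP[_ xs2]; rewrite /cube /=.
  rewrite -ler_sqr ?nnegrE ?sqrtr_ge0// sqr_sqrtr;
    last exact: le_trans (ltW s10) (ltW s12).
  exact: le_trans (sqr_norm_le_sqdist 0 x) xs2.
pose D x := phi x - c * (E (sq x) - E s2).
have cE s : s1 <= s -> {for s, continuous E}.
  by move=> ss; apply/differentiable_continuous/derivable1_diffP; have [] := dE s ss.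
have cD : {within A, continuous D}.
  apply: continuous_in_subspaceT => x /set_mem; rewrite /A /= in_itv /= => /andP[xs _].
  apply: (@continuousB _ _ _ phi (fun x => c * (E (sq x) - E s2))); first exact: cphi.
  apply: (@continuousM _ _ (cst c) (fun x => (E (sq x) - E s2)));
    first exact: cst_continuous.
  apply: (@continuousB _ _ _ (E \o sq) (cst (E s2))); last exact: cst_continuous.
  by apply: (@continuous_comp _ _ _ sq E); [exact: csq|exact: cE].
move=> x xs1 xs2; have Ax : A x by rewrite /A /= in_itv /= xs1.
have [z /set_mem Az Dz] := compact_EVT_min (ex_intro _ x Ax) cA cD.
rewrite leNgt; apply/negP => lt_x.
have Dz0 : D z < 0.
  by apply: le_lt_trans (Dz x (mem_set Ax)) _; rewrite subr_lt0.
move: (Az); rewrite /A /= in_itv /= => /andP[zs1 zs2].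
(* A negative minimum of [D] is interior: [bdry] excludes the inner sphere, and on the outer one [D]
   equals [phi]. *)
have {}zs1 : s1 < sq z.
  rewrite lt_neqAle zs1 andbT; apply/negP => /eqP E0; move: Dz0; apply/negP;
    rewrite -leNgt.
  rewrite /D -E0 subr_ge0; apply: le_trans (bdry z (esym E0)).
  by rewrite mulrBr lerBlDr lerDl mulr_ge0// ltW.
have {}zs2 : sq z < s2.
  rewrite lt_neqAle zs2 andbT; apply/negP => /eqP E0; move: Dz0; apply/negP;
    rewrite -leNgt.
  by rewrite /D E0 subrr mulr0 subr0 ltW.
have z0 : 0 < sq z := lt_trans s10 zs1.
(* The shift for which the barrier touches [phi] from below at [z]. It is nonnegative, so phi z <= c
   E(sq z), as [sub] requires. *)
pose C := c * E s2 - D z.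
pose K s := c * E s - C.
have Kz : K (sq z) = phi z by rewrite /K /C /D; ring.
have C0 : 0 <= C by rewrite subr_ge0; apply: le_trans (ltW Dz0) _;
  rewrite mulr_ge0// ltW.
have dK s : s1 <= s -> is_derive (s : R) 1 K (c * E1 s).
  move=> ss; have := is_deriveB (is_deriveZ c (dE s ss)) (is_derive_cst C s (1 : R)).
  by rewrite subr0.
have H : 4 * sq z * (c * E2 (sq z)) + 2 * n%:R * (c * E1 (sq z)) <= h z.
  apply: (@radial_viscosity K (fun s => c * E1 s)) => //.
  - near=> s; apply: dK; apply: ltW; near: s; exact: lt_nbhsr.
  - exact: (is_deriveZ c (dE1 _ zs1)).
  - have : \forall y \near z, A y.
      have oI : open (sq @^-1` `]s1, s2[%classic).
        by move/continuousP : csq; apply; exact: interval_open.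
      have Iz : (sq @^-1` `]s1, s2[%classic) z by rewrite /= in_itv /= zs1 zs2.
      apply: filterS (open_nbhs_nbhs (conj oI Iz)) => y;
        rewrite /A /= !in_itv /= => /andP[? ?].
      by apply/andP; split; exact: ltW.
    apply: filterS => y Ay; have := Dz y (mem_set Ay).
    by rewrite /K /C {2}/D lerBrDr => Hy; rewrite lerBlDr; move: Hy;
      rewrite mulrBr; lra.
have := sub z zs1; rewrite -Kz /K lerBlDr lerDl => /(_ C0); rewrite ltNge => /negP;
  apply.
by apply: le_trans H; rewrite le_eqVlt; apply/orP; left; apply/eqP; ring.
Unshelve. all: by end_near. Qed.

End comparison.

(** * The barrier [exp (- 2 F(|x|))] *)

Section barrier.
Context (R : realType) (Q : R -> R).
Context (Q_gt0 : forall r : R, 0 <= r -> 0 < Q r)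
  (Q_incr : forall r s : R, 0 <= r -> r <= s -> Q r <= Q s)
  (Q_gt_sqr : forall r : R, 0 <= r -> r ^+ 2 < Q r).
Local Notation F := (sqrt_primitive Q).
Local Notation sQ := (fun t => Num.sqrt (Q t)).

Lemma sqrt_profile_gt0 r : 0 <= r -> 0 < sQ r.
Proof. by move=> r0; rewrite sqrtr_gt0 Q_gt0. Qed.

Lemma sqrt_profile_le r s : 0 <= r -> r <= s -> sQ r <= sQ s.
Proof. by move=> r0 rs; apply: ler_wsqrtr; exact: Q_incr. Qed.

Lemma sqrt_profile_integrable (u : R) :
  (@lebesgue_measure R).-integrable `[0, u] (EFin \o sQ).
Proof.
apply: measurable_bounded_integrable => //.
- rewrite [X in (X < _)%E]lebesgue_measure_itv /=; case: ifPn => // _;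
  by rewrite -EFinB ltry.
(* [Q] is monotone only on [0, +oo); composing with the maximum of 0 and t gives a function monotone
   on the whole line, hence measurable. *)
- apply: (eq_measurable_fun (fun t : R => sQ (Num.max 0 t))).
    by move=> t; rewrite inE /= in_itv /= => /andP[t0 _]; rewrite max_r.
  apply: nondecreasing_measurable => // s t st.
  apply: sqrt_profile_le; first by rewrite le_max lexx.
  by rewrite ge_max !le_max lexx /= st orbT.
- exists (sQ u); split; first exact: num_real.
  move=> M uM t /=; rewrite in_itv /= => /andP[t0 tu].
  by rewrite ger0_norm ?sqrtr_ge0//; apply: le_trans (ltW uM); exact: sqrt_profile_le.
Qed.

Lemma is_derive_sqrt_profile (r : R) : 0 <= r -> derivable Q r 1 ->
  is_derive r 1 sQ ((2 * sQ r)^-1 * derive1 Q r).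
Proof.
move=> r0 dQ; have dQ' : is_derive r 1 Q (derive1 Q r) by split => //; rewrite derive1E.
exact: (is_derive1_comp (is_derive1_sqrt (Q_gt0 r0)) dQ').
Qed.

Lemma is_derive_sqrt_primitive (r : R) : 0 < r -> derivable Q r 1 ->
  is_derive r 1 F (sQ r).
Proof.
move=> r0 dQ.
have cs : {for r, continuous sQ}.
  apply/differentiable_continuous/derivable1_diffP.
  by have [] := is_derive_sqrt_profile (ltW r0) dQ.
have rr : r < r + 1 by rewrite ltrDl.
have [dF EF] := continuous_FTC1_closed rr (sqrt_profile_integrable _) r0 cs.
by split; [exact: dF|rewrite -derive1E; exact: EF].
Qed.

Lemma sqrt_primitive_ge r : 0 <= r -> sQ 0 * r <= F r.
Proof.
move=> r0; rewrite /sqrt_primitive.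
have -> : sQ 0 * r = \int[lebesgue_measure]_(t in `[0, r]) (sQ 0).
  rewrite Rintegral_cst//=; congr (_ * _).
  rewrite lebesgue_measure_itv /= lte_fin; case: ltP => [_|].
    by rewrite -EFinB subr0.
  by move=> h; apply/eqP; rewrite eq_le h r0.
apply: le_Rintegral => //.
- apply: measurable_bounded_integrable => //; last exact: bounded_cst.
  by rewrite [X in (X < _)%E]lebesgue_measure_itv /=; case: ifPn => // _;
    rewrite -EFinB ltry.
- exact: sqrt_profile_integrable.
- by move=> t; rewrite /= in_itv /= => /andP[t0 _]; exact: sqrt_profile_le.
Qed.

Lemma sqrt_primitive_ge0 r : 0 <= r -> 0 <= F r.
Proof.
by move=> r0; apply: le_trans (sqrt_primitive_ge r0); rewrite mulr_ge0// sqrtr_ge0.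
Qed.

Lemma sqrt_primitive_unbounded B : exists A, forall r, A <= r -> B <= F r.
Proof.
have s0 := sqrt_profile_gt0 (lexx 0).
exists (Num.max 0 (B / sQ 0)) => r; rewrite ge_max => /andP[r0 rB].
by apply: le_trans (sqrt_primitive_ge r0); rewrite mulrC -ler_pdivrMr.
Qed.

Definition barrier (s : R) : R := expR (- (2 * F (Num.sqrt s))).

(** The derivative in s of the exponent 2 F(sqrt s); [dg] is the derivative of [g]. *)
Let g (s : R) : R := sQ (Num.sqrt s) / Num.sqrt s.
Let dg (s : R) : R := derive1 Q (Num.sqrt s) / (4 * sQ (Num.sqrt s) * s) -
  sQ (Num.sqrt s) / (2 * s * Num.sqrt s).

Definition barrier1 (s : R) : R := - g s * barrier s.
Definition barrier2 (s : R) : R := (g s ^+ 2 - dg s) * barrier s.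

Lemma barrier_gt0 s : 0 < barrier s.
Proof. exact: expR_gt0. Qed.

Lemma barrier_le1 s : barrier s <= 1.
Proof.
by rewrite /barrier -expR0 ler_expR oppr_le0 mulr_ge0// sqrt_primitive_ge0// sqrtr_ge0.
Qed.

Lemma is_derive_barrier (s : R) : 0 < s -> derivable Q (Num.sqrt s) 1 ->
  is_derive s 1 barrier (barrier1 s).
Proof.
move=> s0 dQ; have r0 : 0 < Num.sqrt s by rewrite sqrtr_gt0.
have dF := is_derive1_comp (is_derive_sqrt_primitive r0 dQ) (is_derive1_sqrt s0).
have dN : is_derive s 1 (fun s : R =>
  - (2 * F (Num.sqrt s))) _ := is_deriveN (is_deriveZ (2 : R) dF).
have H := @is_derive1_comp _ expR (fun s : R =>
  - (2 * F (Num.sqrt s))) s _ _ (is_derive_expR _) dN.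
suff <- : expR (- (2 * F (Num.sqrt s))) * - (2 *: (sQ (Num.sqrt s) *
  (2 * Num.sqrt s)^-1)) = barrier1 s.
  exact: H.
by rewrite /barrier1 /g /barrier /GRing.scale /=; field; rewrite gt_eqF.
Qed.

Lemma is_derive_barrier1 (s : R) : 0 < s -> derivable Q (Num.sqrt s) 1 ->
  is_derive s 1 barrier1 (barrier2 s).
Proof.
move=> s0 dQ; have r0 : 0 < Num.sqrt s by rewrite sqrtr_gt0.
have sq0 := sqrt_profile_gt0 (ltW r0).
have dr := is_derive1_sqrt s0.
have dsQ := is_derive1_comp (is_derive_sqrt_profile (ltW r0) dQ) dr.
have dV := is_deriveV (lt0r_neq0 r0) dr.
have H := is_deriveM (is_deriveN (is_deriveM dsQ dV)) (is_derive_barrier s0 dQ).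
have E : (- ((sQ \o Num.sqrt) * (fun y => (Num.sqrt y)^-1))) * barrier = barrier1 by [].
rewrite E in H; move: H; congr is_derive.
have ss : s = Num.sqrt s * Num.sqrt s by rewrite -expr2 sqr_sqrtr// ltW.
rewrite /barrier2 /barrier1 /g /dg !fctE /GRing.scale /=.
move: (Num.sqrt s) r0 sq0 ss {E dr dsQ dV dQ} => r r0 sq0 ->.
by move: (barrier _) (derive1 Q r) (Num.sqrt (Q r)) sq0 => b q' S S0; field;
  rewrite !gt_eqF.
Qed.

(** At r = |x| the Laplacian of exp(- 2 F) is exp(- 2 F) (4 F'^2 - 2 F'' - 2 (n - 1) F' / r), with
    F' = Q^(1/2) and 2 F'' = Q' / Q^(1/2). *)
Lemma barrier_laplacian (n : nat) (s : R) : 0 < s ->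
  4 * s * barrier2 s + 2 * n%:R * barrier1 s =
  barrier s * (4 * Q (Num.sqrt s) - derive1 Q (Num.sqrt s) / sQ (Num.sqrt s)
    + (2 - 2 * n%:R) * (sQ (Num.sqrt s) / Num.sqrt s)).
Proof.
move=> s0; have r0 : 0 < Num.sqrt s by rewrite sqrtr_gt0.
have sq0 := sqrt_profile_gt0 (ltW r0).
have ss : s = Num.sqrt s * Num.sqrt s by rewrite -expr2 sqr_sqrtr// ltW.
have QQ : Q (Num.sqrt s) = sQ (Num.sqrt s) * sQ (Num.sqrt s).
  by rewrite -expr2 sqr_sqrtr// ltW// Q_gt0// ltW.
rewrite /barrier2 /barrier1 /g /dg [in 4 * Q _]QQ.
move: (Num.sqrt s) r0 sq0 ss {QQ} => r r0 sq0 ->.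
by move: (barrier _) (derive1 Q r) (Num.sqrt (Q r)) sq0 => b q' S S0; field;
  rewrite !gt_eqF.
Qed.

(** Each of the two other terms takes at most Q / 2 from 4 Q. For the first-order term this amounts
    to 4 (n - 1) <= r Q^(1/2), which follows from Q^(1/2) >= r and r^2 >= 4 n. *)
Lemma barrier_subsolution (n : nat) (s : R) : 0 < s ->
  derive1 Q (Num.sqrt s) * Q (Num.sqrt s) `^ (- (3 / 2)) <= 1 / 2 ->
  4 * n%:R <= s ->
  barrier s * (3 * Q (Num.sqrt s)) <= 4 * s * barrier2 s + 2 * n%:R * barrier1 s.
Proof.
move=> s0 dQ ns; rewrite barrier_laplacian// ler_wpM2l ?(ltW (barrier_gt0 s))//.
have r0 : 0 < Num.sqrt s by rewrite sqrtr_gt0.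
have sq0 := sqrt_profile_gt0 (ltW r0).
have Q0 := Q_gt0 (ltW r0).
have ss : s = Num.sqrt s * Num.sqrt s by rewrite -expr2 sqr_sqrtr// ltW.
have QQ : Q (Num.sqrt s) = sQ (Num.sqrt s) * sQ (Num.sqrt s).
  by rewrite -expr2 sqr_sqrtr// ltW.
have sQr : Num.sqrt s <= sQ (Num.sqrt s).
  rewrite -[leLHS]ger0_norm ?sqrtr_ge0// -sqrtr_sqr; apply: ler_wsqrtr.
  exact: ltW (Q_gt_sqr (ltW r0)).
have h1 : derive1 Q (Num.sqrt s) / sQ (Num.sqrt s) <= Q (Num.sqrt s) / 2.
  have E : Q (Num.sqrt s) `^ (- (3 / 2)) = (Q (Num.sqrt s) * sQ (Num.sqrt s))^-1.
    rewrite powRN; congr (_^-1).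
    have -> : 3 / 2 = 1 + 2^-1 :> R by field.
    rewrite powRD ?gt_eqF ?implybT// powRr1 ?(ltW Q0)// powR12_sqrt// ltW//.
  move: dQ; rewrite E ler_pdivrMr ?mulr_gt0// => dQ.
  rewrite ler_pdivrMr//; apply: le_trans dQ _.
  by rewrite le_eqVlt; apply/orP; left; apply/eqP; field.
have h2 : (2 * n%:R - 2) * (sQ (Num.sqrt s) / Num.sqrt s) <= Q (Num.sqrt s) / 2.
  rewrite mulrA ler_pdivrMr// [in leRHS]QQ.
  move: (Num.sqrt s) (Num.sqrt (Q _)) r0 sq0 ss sQr ns {h1 dQ Q0 QQ s0} =>
    r S r0 S0 -> rS ns.
  have : 2 * (2 * n%:R - 2) <= S * r.
    have : r * r <= S * r by rewrite ler_wpM2r// ltW.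
    by lra.
  move=> /(ler_wpM2r (ltW S0)) H.
  rewrite -subr_ge0 (_ : _ - _ = (S * r * S - 2 * (2 * n%:R - 2) * S) / 2);
    last by field.
  by rewrite divr_ge0// subr_ge0.
lra.
Qed.

(** Raising F by 1 divides the barrier by e^2, and e >= 2. *)
Lemma barrier_half (s : R) : 0 < s ->
  exists2 s2, s < s2 & barrier s2 <= barrier s / 2.
Proof.
move=> s0; have [A HA] := sqrt_primitive_unbounded (F (Num.sqrt s) + 1).
pose T := Num.max A (Num.sqrt s + 1).
have T0 : Num.sqrt s < T by rewrite lt_max ltrDl ltr01 orbT.
have T00 : 0 <= T by apply: le_trans (ltW T0); exact: sqrtr_ge0.
exists (T ^+ 2).
  by rewrite -[s]sqr_sqrtr ?(ltW s0)// ltr_sqr ?nnegrE ?sqrtr_ge0.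
rewrite /barrier sqrtr_sqr ger0_norm//.
have FT : F (Num.sqrt s) + 1 <= F T by apply: HA; rewrite le_max lexx.
rewrite ler_pdivlMr//.
apply: (@le_trans _ _ (expR (- (2 * F T)) * expR 1)).
  by rewrite ler_wpM2l ?expR_ge0//; exact: expR_ge1Dx.
rewrite -expRD ler_expR; lra.
Qed.

End barrier.

Lemma iterated_ln_unbounded (R : realType) m (B : R) :
  exists A, forall x, A <= x -> B <= iterated_ln m x.
Proof.
elim: m B => [|m IH] B; first by exists B.
have [A HA] := IH (expR B); exists A => x /HA h.
rewrite /iterated_ln /= -[B]expRK ler_ln ?posrE ?expR_gt0//.
exact: lt_le_trans (expR_gt0 B) h.
Qed.

(** * The ground state *)

Lemma schrodinger_laplacian (R : realType) n (q phi : 'rV[R]_n -> R) (E0 : R) rho r :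
  continuous q -> continuous phi ->
  schrodinger q (fun x => (phi x)%:C%C) (fun x => (E0 * phi x)%:C%C) ->
  (forall k, Ck k rho) -> supported rho r ->
  \int[lebesgue_rV R n]_x (phi x * laplacian rho x) =
  \int[lebesgue_rV R n]_x ((q x - E0) * phi x * rho x).
Proof.
move=> cq cphi sch Crho srho.
have E := schrodinger_distribution cq sch Crho srho.
rewrite (integral_mul_laplacian cphi (Crho 2%N) srho).
have cint (u : 'rV[R]_n -> R) : continuous u ->
    (lebesgue_rV R n).-integrable setT (EFin \o (u * rho)).
  move=> cu; apply: (@integrable_supported _ _ _ r); last exact: supportedMl.
  by apply: continuous_rVM => //; exact: Ck_continuous (Crho 0%N).
transitivity (\int[lebesgue_rV R n]_x (q x * phi x * rho x - E0 * phi x * rho x));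
  last first.
  by apply: eq_Rintegral => x _; rewrite !mulrBl.
rewrite RintegralB//.
- by rewrite -E subKr.
- exact: (cint (q * phi) (continuous_rVM cq cphi)).
- exact: (cint (cst E0 * phi) (continuous_rVM (@cst_continuous _ _ E0) cphi)).
Qed.

Lemma euclidean_normE (R : realType) n (x : 'rV[R]_n) :
  euclidean_norm x = Num.sqrt (sqdist 0 x).
Proof.
by congr Num.sqrt; apply: eq_bigr => i _; rewrite mxE subr0.
Qed.

Lemma ground_state_lower_bound (R : realType) (n : nat) (Q : R -> R)
  (Q_gt0 : forall r : R, 0 <= r -> 0 < Q r)
  (Q_incr : forall r s : R, 0 <= r -> r <= s -> Q r <= Q s)
  (Q_gt_sqr : forall r : R, 0 <= r -> r ^+ 2 < Q r)
  (Rm : R) (Rm_gt0 : 0 < Rm)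
  (Q_derivable : forall r : R, Rm < r -> derivable Q r 1)
  (Q_derive : (fun r : R => derive1 Q r * Q r `^ (- (3 / 2))) @ +oo --> (0 : R))
  (q : 'rV[R]_n -> R) (q_cont : continuous q)
  (q_le : forall x : 'rV[R]_n, Rm <= euclidean_norm x -> q x <= Q (euclidean_norm x))
  (phi : 'rV[R]_n -> R) (phi_ground : ground_state q phi) :
  exists R0 c : R, 0 < c /\ forall x, R0 <= euclidean_norm x ->
    c * expR (- (2 * sqrt_primitive Q (euclidean_norm x))) <= phi x.
Proof.
have [cphi phi0 _ [E0 _ sch]] := phi_ground.
have [M [_ HM]] : \forall r \near +oo, derive1 Q r * Q r `^ (- (3 / 2)) <= 1 / 2.
  have : (0 : R) < 1 / 2 by lra.
  exact: (cvgr_le _ Q_derive).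
(* Beyond R0, [Q] is differentiable, q <= Q, and Q' Q^(-3/2) <= 1/2. The last entry makes R0 >= 1,
   hence R0^2 >= |E0| + 4 n, which gives - E0 <= Q and the condition of [barrier_subsolution]. *)
pose R0 := Num.max (Rm + 1) (Num.max (M + 1) (`|E0| + 4 * n%:R + 1)).
have [R0m R0M R0E] : [/\ Rm < R0, M < R0 & `|E0| + 4 * n%:R + 1 <= R0].
  by split; rewrite /R0 ?lt_max ?le_max ?lexx ?ltrDl ?ltr01 ?orbT.
have R01 : 1 <= R0 by apply: le_trans R0E; rewrite lerDr addr_ge0// mulr_ge0.
have R00 : 0 < R0 := lt_le_trans ltr01 R01.
have R0sq : `|E0| + 4 * n%:R <= R0 ^+ 2.
  apply: (@le_trans _ _ R0); first by apply: le_trans R0E; rewrite lerDl.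
  by rewrite expr2 ler_peMr// ltW.
have sq_gt s : R0 ^+ 2 <= s -> R0 <= Num.sqrt s.
  by move=> /ler_wsqrtr; rewrite sqrtr_sqr ger0_norm// ltW.
have s10 : 0 < R0 ^+ 2 by rewrite exprn_gt0.
have [z _ Hz] : exists2 z, z \in cube 0 R0 & forall t, t \in cube 0 R0 ->
  phi z <= phi t.
  apply: compact_EVT_min; last exact: continuous_subspaceT.
  - by exists 0; rewrite /cube /= subrr normr0 ltW.
  - exact: compact_cube.
(* The cube contains the Euclidean sphere of radius R0 and the barrier is at most 1, so this minimum
   gives the inequality on the inner sphere. *)
pose c := phi z.
have c0 : 0 < c by exact: phi0.
exists R0, (c / 2); split; first by rewrite divr_gt0.
move=> x; rewrite euclidean_normE => xR.
have sx0 : R0 ^+ 2 <= sqdist 0 x.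
  by rewrite -[sqdist 0 x]sqr_sqrtr ?sqdist_ge0// ler_sqr ?nnegrE ?sqrtr_ge0// ltW.
(* Subtracting the barrier at [s2] costs at most half its value at x, whence the constant c / 2. *)
have [s2 xs2 hs2] := barrier_half Q_gt0 Q_incr (lt_le_trans s10 sx0).
have ch : continuous (fun x => (q x - E0) * phi x).
  apply: (@continuous_rVM _ _ (fun x => q x - E0)) => // y.
  by apply: (@continuousB _ _ _ q (cst E0)); [exact: q_cont|exact: cst_continuous].
have := @radial_comparison R n phi (fun x => (q x - E0) * phi x) cphi ch
  (fun rho r Crho srho _ => schrodinger_laplacian q_cont cphi sch Crho srho)
  (barrier Q) (barrier1 Q) (barrier2 Q) (R0 ^+ 2) s2 c s10
    (le_lt_trans sx0 xs2) c0 phi0.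
have dQ s : R0 ^+ 2 <= s -> derivable Q (Num.sqrt s) 1.
  by move=> /sq_gt h; apply: Q_derivable; exact: lt_le_trans h.
move=> /(_ _ _ _ _ _ x sx0 (ltW xs2)) H.
have {}H : c * (barrier Q (sqdist 0 x) - barrier Q s2) <= phi x.
  apply: H.
  - by move=> s hs; apply: is_derive_barrier => //; [exact: lt_le_trans hs|exact: dQ].
  - move=> s hs; apply: is_derive_barrier1 => //; first exact: lt_trans hs.
    by apply: dQ; exact: ltW.
  - exact: ltW (barrier_gt0 _ _).
  - move=> y ys; apply: (@le_trans _ _ c).
      by rewrite ger_pMr// barrier_le1.
    apply: Hz; rewrite inE /cube /= -ler_sqr ?nnegrE ?(ltW R00)// -ys.
    exact: sqr_norm_le_sqdist.
  - move=> y ys phiy; have y0 : 0 < sqdist 0 y := lt_trans s10 ys.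
    have yR := sq_gt _ (ltW ys).
    have Q0 : 0 < Q (Num.sqrt (sqdist 0 y)) by apply: Q_gt0; exact: sqrtr_ge0.
    have E0Q : - E0 <= Q (Num.sqrt (sqdist 0 y)).
      apply: le_trans (ltW (Q_gt_sqr _ (sqrtr_ge0 (sqdist 0 y)))).
      rewrite sqr_sqrtr ?(ltW y0)//.
      apply: le_trans (ltW ys); apply: le_trans R0sq.
      by apply: le_trans (ler_norm _) _; rewrite normrN lerDl mulr_ge0.
    have qQ : q y <= Q (Num.sqrt (sqdist 0 y)).
      rewrite -euclidean_normE; apply: q_le; rewrite euclidean_normE.
      exact: le_trans (ltW R0m) yR.
    have b0 := barrier_gt0 Q (sqdist 0 y).
    (* q - E0 <= 2 Q while the barrier provides 3 Q: the gap gives the strict inequality. *)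
    apply: (@le_lt_trans _ _ (2 * Q (Num.sqrt (sqdist 0 y)) * (c * barrier Q
      (sqdist 0 y)))).
      apply: (@le_trans _ _ (2 * Q (Num.sqrt (sqdist 0 y)) * phi y)).
        by rewrite ler_wpM2r ?(ltW (phi0 y))// mulr_natl mulr2n lerD.
      by rewrite ler_wpM2l// mulr_ge0// ltW.
    have S : barrier Q (sqdist 0 y) * (3 * Q (Num.sqrt (sqdist 0 y))) <= _ :=
      barrier_subsolution Q_gt0 Q_gt_sqr (n := n) y0 (HM _ (lt_le_trans R0M yR)) _.
    apply: (@lt_le_trans _ _ (c * (barrier Q (sqdist 0 y) * (3 * Q (Num.sqrt
      (sqdist 0 y)))))).
      have -> : 2 * Q (Num.sqrt (sqdist 0 y)) * (c * barrier Q (sqdist 0 y)) =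
        c * (barrier Q (sqdist 0 y) * (2 * Q (Num.sqrt (sqdist 0 y)))) by ring.
      by rewrite (ltr_pM2l c0) (ltr_pM2l b0) (ltr_pM2r Q0) ltr_nat.
    rewrite ler_pM2l//; apply: S.
    by apply: le_trans (ltW ys); apply: le_trans R0sq; rewrite lerDr.
apply: le_trans H; rewrite -/(barrier Q _).
have -> : c / 2 * barrier Q (sqdist 0 x) = c * (barrier Q (sqdist 0 x) / 2) by field.
rewrite ler_wpM2l ?(ltW c0)// [in leRHS](splitr (barrier Q (sqdist 0 x))).
by rewrite -addrA lerDl subr_ge0.
Qed.

Theorem lemma2p1 (R : realType) (n : nat) (hn : (3 <= n)%N)
  (Q : R -> R)
  (Q_gt0 : forall r : R, 0 <= r -> 0 < Q r)
  (Q_incr : forall r s : R, 0 <= r -> r <= s -> Q r <= Q s)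
  (Q_gt_sqr : forall r : R, 0 <= r -> r ^+ 2 < Q r)
  (k : R) (k_gt0 : 0 < k) (m : nat) (m_gt0 : (0 < m)%N)
  (Rm : R) (Rm_gt0 : 0 < Rm)
  (Rm_large : forall r : R, Rm <= r ->
     iterated_ln_defined m (sqrt_primitive Q r) /\
     0 <= iterated_ln m (sqrt_primitive Q r))
  (Q_derivable : forall r : R, Rm < r -> derivable Q r 1)
  (Q_derive : (fun r : R => derive1 Q r * Q r `^ (- (3 / 2))) @ +oo --> (0 : R))
  (Q_bounds : forall r : R, Rm < r ->
     r ^+ 2 < sqrt_primitive Q r * iterated_ln m (sqrt_primitive Q r) `^ k /\
     sqrt_primitive Q r * iterated_ln m (sqrt_primitive Q r) `^ k < Q r)
  (d : R) (d_gt0 : 0 < d) (d_lt1 : d < 1)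
  (q : 'rV[R]_n -> R)
  (q_ge0 : forall x : 'rV[R]_n, 0 <= q x)
  (q_cont : continuous q)
  (q_bounds : forall x : 'rV[R]_n, Rm <= euclidean_norm x ->
     d * (sqrt_primitive Q (euclidean_norm x) *
          iterated_ln m (sqrt_primitive Q (euclidean_norm x)) `^ k) <= q x /\
     q x <= Q (euclidean_norm x))
  (phi : 'rV[R]_n -> R)
  (phi_ground : ground_state q phi) :
  rosen_inequalities q phi.
Proof.
have [R0 [c [c0 lower]]] := ground_state_lower_bound Q_gt0 Q_incr Q_gt_sqr Rm_gt0
  Q_derivable Q_derive q_cont (fun x hx => (q_bounds x hx).2) phi_ground.
have [cphi phi0 _ _] := phi_ground.
move=> eps eps0.
(* Once the k-th power of the iterated logarithm reaches L, eps q >= eps d F L = 2 F. *)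
pose L := 2 / (eps * d).
have L0 : 0 < L by rewrite divr_gt0// mulr_gt0.
have [A HA] := iterated_ln_unbounded m (L `^ k^-1).
have [B HB] := sqrt_primitive_unbounded Q_gt0 Q_incr A.
pose R1 := Num.max (Num.max Rm R0) (Num.max B 0).
have [z _ Hz] : exists2 z, z \in cube 0 R1 & forall t, t \in cube 0 R1 ->
  phi z <= phi t.
  apply: compact_EVT_min; last exact: continuous_subspaceT.
  - by exists 0; rewrite /cube /= subrr normr0 !le_max lexx !orbT.
  - exact: compact_cube.
(* The first term serves up to R1, the second beyond R1; the 1 ensures positivity. *)
exists (`|ln (phi z)| + `|ln c| + 1); first by rewrite ltr_wpDl// addr_ge0.
apply: aeW => x.
have [xR|xR] := leP (euclidean_norm x) R1.
  apply: (@le_trans _ _ (`|ln (phi z)|)).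
    apply: (@le_trans _ _ (- ln (phi z))); last by rewrite -normrN ler_norm.
    rewrite lerN2 ler_ln ?posrE//; apply: Hz; rewrite inE /cube /=.
    rewrite -ler_sqr ?nnegrE ?(le_trans _ xR) ?sqrtr_ge0//.
    apply: le_trans (sqr_norm_le_sqdist 0 x) _.
    rewrite -[leLHS]sqr_sqrtr ?sqdist_ge0// -euclidean_normE.
    by rewrite ler_sqr ?nnegrE ?(le_trans _ xR) ?sqrtr_ge0.
  apply: (@le_trans _ _ (`|ln (phi z)| + `|ln c| + 1)).
    by rewrite -addrA lerDl addr_ge0.
  by rewrite lerDr mulr_ge0// ltW.
move: xR; rewrite !gt_max => /andP[/andP[xRm xR0] /andP[xB x0]].
have F0 := sqrt_primitive_ge0 Q_incr (ltW x0).
set F := sqrt_primitive Q (euclidean_norm x) in F0 *.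
have lnphi : - ln (phi x) <= 2 * F - ln c.
  have : ln (c * expR (- (2 * F))) <= ln (phi x).
    by rewrite ler_ln ?posrE ?mulr_gt0 ?expR_gt0//; exact: lower x (ltW xR0).
  by rewrite lnM ?posrE ?expR_gt0// expRK; lra.
have itL : L <= iterated_ln m F `^ k.
  rewrite -[L]powRr1 ?(ltW L0)// -(mulVf (lt0r_neq0 k_gt0)) powRrM.
  apply: ge0_ler_powR; rewrite ?nnegrE ?powR_ge0 ?(ltW k_gt0)//.
    by apply: le_trans (HA _ (HB _ (ltW xB))); exact: powR_ge0.
  exact: HA (HB _ (ltW xB)).
have qF : 2 * F <= eps * q x.
  apply: (@le_trans _ _ (eps * (d * (F * L)))).
    by rewrite /L le_eqVlt; apply/orP; left; apply/eqP; field; rewrite !gt_eqF.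
  rewrite ler_pM2l//; apply: le_trans (q_bounds x (ltW xRm)).1.
  by rewrite ler_pM2l// ler_wpM2l.
have := ler_norm (- ln c); rewrite normrN => h; have := normr_ge0 (ln (phi z)); lra.
Qed.
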